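(* Let $k\ge 2$ be an integer and let $\widehat{\zeta}(\tau,\vec z)=\sum_{j=0}^{k-2}\binom{k-2}{j}\,\zeta^*_{\Lambda_\tau}(z_j)\,e_1^{j}e_2^{k-2-j}\in\mathrm{Sym}^{k-2}(\mathbb{C}^2)$ for $\tau\in\mathbb{H}$ and $\vec z=(z_0,\dots,z_{k-2})\in\mathbb{C}^{k-1}$. Then $\widehat\zeta$ is a (non-holomorphic) Jacobi form of weight $1$ and index $0$, invariant under the lattice $\Lambda_\tau^{k-1}$. That is, for all $\begin{pmatrix}a&b\\c&d\end{pmatrix}\in \mathrm{SL}_2(\mathbb{Z})$ and all $\vec m,\vec n\in\mathbb{Z}^{k-1}$, $$\widehat\zeta\Big(\frac{a\tau+b}{c\tau+d},\frac{\vec z}{c\tau+d}\Big)=(c\tau+d)\,\widehat\zeta(\tau,\vec z),\qquad \widehat\zeta(\tau,\vec z+\vec m\tau+\vec n)=\widehat\zeta(\tau,\vec z),$$ for all $\tau\in\mathbb{H}$ and all $\vec z\in\mathbb{C}^{k-1}$ with no $z_j\in\Lambda_\tau$.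
   Context: $\mathbb{H}$ is the complex upper half-plane and $\Lambda_\tau=\mathbb{Z}+\mathbb{Z}\tau$. $(e_1,e_2)$ is the standard basis of $\mathbb{C}^2$, and $\mathrm{Sym}^{k-2}(\mathbb{C}^2)$ is the space of homogeneous polynomials of degree $k-2$ in $e_1,e_2$. The Weierstrass $\zeta$-function of $\Lambda_\tau$ is $\zeta_{\Lambda_\tau}(z)=\frac1z+\sum_{\omega\in\Lambda_\tau\setminus\{0\}}\left(\frac{1}{z-\omega}+\frac1\omega+\frac{z}{\omega^2}\right)$. Its completion is $\zeta^*_{\Lambda_\tau}(z)=\zeta_{\Lambda_\tau}(z)-z\,G_2^*(\tau)-\frac{\pi\bar z}{\mathrm{Im}(\tau)}$, where $G_2^*(\tau)=G_2(\tau)-\frac{\pi}{\mathrm{Im}(\tau)}$ and $G_2$ is the (quasimodular) holomorphic Eisenstein series of weight $2$ for $\mathrm{SL}_2(\mathbb{Z})$ normalized to have constant term $2\zeta(2)=\pi^2/3$, i.e. $G_2(\tau)=\frac{\pi^2}{3}\left(1-24\sum_{n\ge1}\left(\sum_{d\mid n}d\right)e^{2\pi i n\tau}\right)$. *)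

(* Defs.v *)
From HB Require Import structures.
From mathcomp Require Import all_boot all_order all_algebra complex.
From mathcomp Require Import all_classical all_reals all_analysis.
(* mpoly's notations clash with those of MathComp-Analysis, and
   [summability.sum] would shadow the sum type. *)
From mathcomp Require mpoly.
From mathcomp Require showcase.summability.
Import -(notations) mpoly.

Set Implicit Arguments.
Unset Strict Implicit.
Unset Printing Implicit Defensive.

Import Order.TTheory GRing.Theory Num.Theory.
Import numFieldNormedType.Exports.

Local Open Scope classical_set_scope.
Local Open Scope complex_scope.
Local Open Scope ring_scope.

(* The usual topology of C (that of the modulus), put on [R[i]] itself in the
   way [numFieldNormedType] puts it on an abstract numFieldType. *)
Section complex_topology.
Variable R : realType.
#[non_forgetful_inheritance]
HB.instance Definition _ := GRing.ComAlgebra.copy R[i] R[i]^o.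
#[non_forgetful_inheritance]
HB.instance Definition _ := Vector.copy R[i] R[i]^o.
#[non_forgetful_inheritance]
HB.instance Definition _ := NormedModule.copy R[i] R[i]^o.
HB.instance Definition _ := Num.ClosedField.on R[i].
End complex_topology.

Section zeta.
Variable R : realType.
Local Notation C := R[i].
Implicit Types (tau z w : C).

Definition lattice tau : set C :=
  [set w | exists m n : int, w = m%:~R + n%:~R * tau].

(* Unordered sum over D: the limit of the finite partial sums along the
   directed set of finite subsets. *)
Definition sum_over (D : set C) (f : C -> C) : C :=
  summability.sum (fun w : C => if w \in D then f w else 0).

Definition zeta tau z : C :=
  z^-1 + sum_over (lattice tau `\ 0)
           (fun w => (z - w)^-1 + w^-1 + z / w ^+ 2).

Definition cexp z : C :=
  (expR (complex.Re z))%:C * (cos (complex.Im z) +i* sin (complex.Im z)).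

Definition sigma1 (n : nat) : nat := (\sum_(d <- divisors n) d)%N.

Definition G2 tau : C :=
  (pi ^+ 2 / 3)%:C *
  (1 - 24 * \big[+%R/0]_(1 <= n <oo)
              ((sigma1 n)%:R * cexp ((2 * pi)%:C * 'i%C * n%:R * tau))).

Definition G2star tau : C := G2 tau - (pi / complex.Im tau)%:C.

Definition zetastar tau z : C :=
  zeta tau z - z * G2star tau - pi%:C * conjc z / (complex.Im tau)%:C.

Definition e1 : mpoly 2 C := mpolyX C (mnm1 0).
Definition e2 : mpoly 2 C := mpolyX C (mnm1 1).

Definition Sym (d : nat) := dhomog 2 C d.

Definition zetahat_poly (k : nat) tau (z : 'rV[C]_(k - 1)) : mpoly 2 C :=
  \sum_(j < k - 1) ('C(k - 2, j)%:R * zetastar tau (z 0 j)) *: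
                     (e1 ^+ j * e2 ^+ (k - 2 - j)).

Lemma zetahat_homog (k : nat) tau (z : 'rV[C]_(k - 1)) :
  zetahat_poly tau z \is ishomog1 (k - 2) mdeg.
Proof.
apply: rpred_sum => j _; apply: rpredZ.
have lt_jk : (1 + j < k)%N by rewrite -ltn_subRL.
have le_jk : (j <= k - 2)%N.
  by rewrite leq_subRL // (leq_trans _ lt_jk).
have homX (i : 'I_2) : mpolyX C (mnm1 i) \is ishomog1 1 mdeg.
  by rewrite dhomogX /= mdeg1.
have := dhomogM (dhomogMn j (homX 0)) (dhomogMn (k - 2 - j) (homX 1)).
by rewrite !mul1n subnKC.
Qed.

Definition zetahat (k : nat) tau (z : 'rV[C]_(k - 1)) : Sym (k - 2) :=
  DHomog (zetahat_homog tau z).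

Definition automorphy (g : 'M[int]_2) tau : C :=
  (g 1 0)%:~R * tau + (g 1 1)%:~R.

Definition mobius (g : 'M[int]_2) tau : C :=
  ((g 0 0)%:~R * tau + (g 0 1)%:~R) / automorphy g tau.

End zeta.

(* Main.v *)
Require Import Defs.
From mathcomp Require Import all_boot all_order all_algebra complex.
From mathcomp Require Import all_classical all_reals all_analysis.
From mathcomp Require Import finmap ring lra zify.
From mathcomp Require mpoly.
From mathcomp Require showcase.summability.
Import -(notations) mpoly.

Set Implicit Arguments.
Unset Strict Implicit.
Unset Printing Implicit Defensive.

Import Order.TTheory GRing.Theory Num.Theory.
Import numFieldNormedType.Exports ComplexField.Normc.

Local Open Scope classical_set_scope.
Local Open Scope complex_scope.
Local Open Scope ring_scope.

(* Summing the zeta series row by row, with the partial fraction expansions of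
   pi cot(pi z) and (pi / sin(pi z))^2, gives
     zeta(z) - z G_2 = lim_N sum_(|n| <= N) pi cot(pi (z + n tau)),
   since the q-expansion of the squared cosecants is that of G_2.  The right
   hand side is 1-periodic, and z -> z + tau telescopes to the limits -+ pi i of
   the cotangent; so the quasi-periods of zeta are G_2 and tau G_2 - 2 pi i, and
   the correction terms of zeta^* cancel exactly these.
   Modularity: zeta is homogeneous of degree -1 in (lattice, z).  The
   quasi-period of zeta at w is w G_2^* + pi conj(w) / Im(tau) for every w in the
   lattice, so homogeneity also forces G_2^* to have weight 2.
   The partial fractions come from iterating the duplication formulas of the
   cotangent and squared cosecant and passing to the limit termwise. *)

(** The obstacle is the order of summation. A term of the zeta series is of order [|w|^-3], so the
    whole converges absolutely, but its three parts do not converge absolutely over the lattice.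
    [G2] appears only because rows are summed first, whereas homogeneity under a change of lattice
    basis needs a sum independent of any order. Both views are reconciled by unordered sums: they
    can be reindexed along injections, and an iterated limit along suitable finite boxes recovers
    the same value. The passage from squared cosecants to the divisor sums in [G2] is again one
    double family summed in two orders. No residue or Liouville argument occurs. The [2 pi i] of
    Legendre's relation comes out as the difference of the two limits of the cotangent. The row
    through the origin is treated apart, since the squared cosecant has a pole there; its share, the
    constant term [pi^2 / 3], needs Euler's value of [zeta(2)], obtained from the squared cosecant
    at [1 / 2]. *)

(* A sealed copy of [u @ F --> l]: applying the library's limit lemmas directly
   at [R[i]] makes unification diverge on its topological structures. *)
Variant tends (K : numFieldType) (T : Type) (F : set_system T)
  (u : T -> K) (l : K) : Prop := Tends of u @ F --> l.

(** * Algebra of limits *)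

Section Tends.
Variables (K : numFieldType) (T : Type) (F : set_system T).
Implicit Types (u v : T -> K) (a b : K).

Lemma tendsP {FF : Filter F} u a :
  tends F u a <-> forall e, 0 < e -> \forall x \near F, `|u x - a| < e.
Proof.
split=> [[/cvgrPdistC_lt//]|h]; split; apply/cvgrPdistC_lt; exact: h.
Qed.

Lemma eq_tends u v a : u =1 v -> tends F u a -> tends F v a.
Proof. by move=> /funext ->. Qed.

Lemma near_eq_tends {FF : Filter F} u v a :
  (\forall x \near F, u x = v x) -> tends F u a -> tends F v a.
Proof.
move=> uv ua; apply/tendsP => e e0; move/tendsP: ua => /(_ e e0).
by apply: filterS2 uv => x ->.
Qed.

Lemma tends_cst {FF : Filter F} a : tends F (fun=> a) a.
Proof. split; exact: cvg_cst. Qed.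

Lemma tendsD {FF : Filter F} u v a b :
  tends F u a -> tends F v b -> tends F (fun x => u x + v x) (a + b).
Proof. by move=> [ua] [vb]; split; apply: cvgD. Qed.

Lemma tendsN {FF : Filter F} u a : tends F u a -> tends F (fun x => - u x) (- a).
Proof. by move=> [ua]; split; apply: cvgN. Qed.

Lemma tendsB {FF : Filter F} u v a b :
  tends F u a -> tends F v b -> tends F (fun x => u x - v x) (a - b).
Proof. by move=> [ua] [vb]; split; apply: cvgB. Qed.

Lemma tendsM {FF : Filter F} u v a b :
  tends F u a -> tends F v b -> tends F (fun x => u x * v x) (a * b).
Proof. by move=> [ua] [vb]; split; apply: cvgM. Qed.

Lemma tendsZ {FF : Filter F} c u a :
  tends F u a -> tends F (fun x => c * u x) (c * a).
Proof. by move=> ua; apply: tendsM => //; apply: tends_cst. Qed.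


Lemma tendsX {FF : Filter F} n u a :
  tends F u a -> tends F (fun x => u x ^+ n) (a ^+ n).
Proof.
move=> ua; elim: n => [|n IHn]; first exact: tends_cst.
rewrite exprS; by apply: (eq_tends _ (tendsM ua IHn)) => x; rewrite exprS.
Qed.

Lemma tendsV {FF : Filter F} u a :
  a != 0 -> tends F u a -> tends F (fun x => (u x)^-1) a^-1.
Proof. by move=> a0 [ua]; split; apply: cvgV. Qed.

Lemma tends_sum {FF : Filter F} (I : Type) (r : seq I) (P : pred I)
    (u : I -> T -> K) (a : I -> K) :
  (forall i, P i -> tends F (u i) (a i)) ->
  tends F (fun x => \sum_(i <- r | P i) u i x) (\sum_(i <- r | P i) a i).
Proof.
move=> h; elim: r => [|i r IHr].
  rewrite big_nil; apply: (@eq_tends (fun=> 0)) => [x|].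
    by rewrite big_nil.
  exact: tends_cst.
rewrite big_cons; case: ifPn => Pi.
  by apply: (eq_tends _ (tendsD (h _ Pi) IHr)) => x; rewrite big_cons Pi.
by apply: (eq_tends _ IHr) => x; rewrite big_cons (negPf Pi).
Qed.

Lemma tends_unique {FF : ProperFilter F} u a b :
  tends F u a -> tends F u b -> a = b.
Proof. by move=> [ua] [ub]; apply: cvg_unique ua ub; apply: norm_hausdorff. Qed.

End Tends.

Section SeqTends.
Variable K : numFieldType.
Implicit Types (u v : nat -> K) (a b : K).

Lemma tends_ooP u a : tends \oo u a <->
  forall e, 0 < e -> exists N, forall n, (N <= n)%N -> `|u n - a| < e.
Proof.
split=> [/tendsP h e /h[N _ hN]|h].
  by exists N => n; apply: hN.
by apply/tendsP => e /h[N hN]; exists N.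
Qed.

Lemma eventually_eq_tends N u v a :
  (forall n, (N <= n)%N -> u n = v n) -> tends \oo u a -> tends \oo v a.
Proof. by move=> uv; apply: near_eq_tends; exists N. Qed.

Lemma tends_comp_nat (f : nat -> nat) u a :
  (forall n, (n <= f n)%N) -> tends \oo u a -> tends \oo (u \o f) a.
Proof.
move=> fn /tends_ooP h; apply/tends_ooP => e /h[N hN]; exists N => n Nn.
exact/hN/(leq_trans Nn).
Qed.

Lemma tends_series (u : nat -> K) a :
  tends \oo (fun n => \sum_(1 <= i < n) u i) a ->
  \big[+%R/0]_(1 <= n <oo) u n = a.
Proof. by move=> [h]; apply: cvg_lim h. Qed.

Lemma tends_summability_sum (I : choiceType) (f : I -> K) a :
  tends (@summability.totally I) (summability.partial_sum f) a ->
  summability.sum f = a.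
Proof.
move=> [h]; apply: (@cvg_lim _ _ _ _ summability.totally_filter) h.
exact: norm_hausdorff.
Qed.

End SeqTends.

Section RealBounds.
Variable R : realType.

Lemma tends_harmonic (c : R) : tends \oo (fun n => c / n.+1%:R) 0.
Proof.
rewrite -(mulr0 c); apply: tendsZ; split; exact: cvg_harmonic.
Qed.

Lemma tends_geometric (c r : R) :
  0 <= r < 1 -> tends \oo (fun n => c * r ^+ n) 0.
Proof.
by move=> /andP[r0 r1]; rewrite -(mulr0 c); apply: tendsZ;
  split; apply: cvg_expr; rewrite ger0_norm.
Qed.

(** Telescoping: for [b >= 1], [1 / b^2 <= 2 / (b (b + 1)) = 2 / b - 2 / (b + 1)]. Being uniform in
    [n], the bound controls both the tails in [tannery] and the majorant of the lattice sum. *)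
Lemma sum_inv_sqr_le (a : R) n : 0 < a ->
  1 <= a -> \sum_(k < n) ((a + k%:R) ^+ 2)^-1 <= 2 / a.
Proof.
move=> a0 a1.
suff: \sum_(k < n) ((a + k%:R) ^+ 2)^-1 <= 2 / a - 2 / (a + n%:R).
  move/le_trans; apply; rewrite gerBl divr_ge0// addr_ge0//; lra.
elim: n => [|n IHn]; first by rewrite big_ord0 addr0 subrr.
rewrite big_ord_recr /=.
have n0 : 0 <= n%:R :> R by [].
have h : ((a + n%:R) ^+ 2)^-1 <= 2 / (a + n%:R) - 2 / (a + n.+1%:R).
  rewrite -(natr1 n); set b := a + n%:R; have b1 : 1 <= b by rewrite /b; lra.
  rewrite addrA -/b.
  have -> : 2 / b - 2 / (b + 1) = 2 / (b * (b + 1)) by field; lra.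
  rewrite ler_pdivlMr ?mulr_gt0; [|lra..].
  rewrite mulrC -ler_pdivlMr ?invr_gt0 ?exprn_gt0; [|lra..].
  rewrite invrK; nra.
lra.
Qed.

End RealBounds.

(** * Complex-valued limits and unordered sums *)

Section ComplexTends.
Variable R : realType.
Local Notation C := R[i].

Lemma normrE (z : C) : `|z| = (normc z)%:C.
Proof. by []. Qed.

Lemma ler_normcD (x y : C) : normc (x + y) <= normc x + normc y.
Proof. by rewrite -lecR rmorphD; apply: (@ler_normD _ R[i]). Qed.

Lemma normcN (z : C) : normc (- z) = normc z.
Proof. by apply: (@complexI R); apply: (@normrN R[i] R[i]). Qed.

Lemma normc_ge0 (z : C) : 0 <= normc z.
Proof. by case: z => x y; apply: sqrtr_ge0. Qed.

Lemma normc_gt0 (z : C) : (0 < normc z) = (z != 0).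
Proof. by rewrite -ltcR -normrE normr_gt0. Qed.

Lemma normc_eq0 (z : C) : (normc z == 0) = (z == 0).
Proof. by apply: negb_inj; rewrite -normc_gt0 lt0r normc_ge0 andbT. Qed.

Lemma normcX (z : C) n : normc (z ^+ n) = normc z ^+ n.
Proof. by elim: n => [|n IHn]; rewrite ?expr0 ?normc1// !exprS normcM IHn. Qed.

Lemma normcB (x y : C) : normc (x - y) = normc (y - x).
Proof. by rewrite -normcN opprB. Qed.

Lemma normcR (x : R) : normc x%:C = `|x|.
Proof. by rewrite /= expr0n/= addr0 sqrtr_sqr. Qed.

Lemma normc_nat n : normc (n%:R : C) = n%:R.
Proof. by rewrite -(rmorph_nat (real_complex R)) normcR normr_nat. Qed.

Lemma normc_int (n : int) : normc (n%:~R : C) = `|n|%:~R.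
Proof. by rewrite -(rmorph_int (real_complex R)) normcR intr_norm. Qed.

Lemma normc_sqr (z : C) :
  normc z ^+ 2 = (complex.Re z) ^+ 2 + (complex.Im z) ^+ 2.
Proof. by case: z => x y; rewrite sqr_sqrtr// addr_ge0 ?sqr_ge0. Qed.

Lemma Re_le_normc (z : C) : `|complex.Re z| <= normc z.
Proof. by rewrite -lecR -normrE normc_ge_Re. Qed.

Lemma Im_le_normc (z : C) : `|complex.Im z| <= normc z.
Proof.
rewrite -(@ler_pXn2r _ 2) ?nnegrE ?normc_ge0// normc_sqr real_normK ?num_real//.
by rewrite lerDr sqr_ge0.
Qed.

Lemma normc_le_ReIm (z : C) : normc z <= `|complex.Re z| + `|complex.Im z|.
Proof.
rewrite -(@ler_pXn2r _ 2) ?nnegrE ?normc_ge0 ?addr_ge0// normc_sqr.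
rewrite -(real_normK (num_real (complex.Re z))).
rewrite -(real_normK (num_real (complex.Im z))).
have := normr_ge0 (complex.Re z); have := normr_ge0 (complex.Im z); nra.
Qed.

Lemma ler_normc_sub (x y : C) : normc x - normc y <= normc (x - y).
Proof. by rewrite lerBlDr (le_trans _ (ler_normcD _ _))// subrK. Qed.

Lemma ler_normc_sum (I : Type) (r : seq I) (P : pred I) (f : I -> C) :
  normc (\sum_(i <- r | P i) f i) <= \sum_(i <- r | P i) normc (f i).
Proof.
elim/big_rec2: _ => [|i y x _ yx]; first by rewrite normc0.
by rewrite (le_trans (ler_normcD _ _))// lerD2l.
Qed.

Lemma tendscP (T : Type) (F : set_system T) {FF : Filter F} (u : T -> C) a :
  tends F u a <->
  forall e : R, 0 < e -> \forall x \near F, normc (u x - a) < e.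
Proof.
split=> [/tendsP h e e0|h].
  have /h : 0 < e%:C by rewrite ltcR.
  by apply: filterS => x; rewrite normrE ltcR.
apply/tendsP => e e0.
have eE : e = (complex.Re e)%:C by rewrite RRe_real// gtr0_real.
have /h : 0 < complex.Re e by rewrite -ltcR -eE.
by apply: filterS => x; rewrite normrE eE ltcR.
Qed.

Lemma tendsc_ooP (u : nat -> C) a : tends \oo u a <->
  forall e : R, 0 < e -> exists N, forall n, (N <= n)%N -> normc (u n - a) < e.
Proof.
split=> [/tendscP h e /h[N _ hN]|h].
  by exists N => n; apply: hN.
by apply/tendscP => e /h[N hN]; exists N.
Qed.

Lemma tends_squeeze N (u : nat -> C) (v : nat -> R) a :
  (forall n, (N <= n)%N -> normc (u n - a) <= v n) -> tends \oo v 0 ->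
  tends \oo u a.
Proof.
move=> uv /tends_ooP v0; apply/tendsc_ooP => e /v0[M hM].
exists (maxn N M) => n; rewrite geq_max => /andP[Nn Mn].
apply: le_lt_trans (uv _ Nn) _; apply: le_lt_trans (hM _ Mn).
by rewrite subr0 ler_norm.
Qed.

Lemma tendsR (T : Type) (F : set_system T) {FF : Filter F} (u : T -> R) a :
  tends F u a -> tends F (fun x => (u x)%:C) a%:C.
Proof.
move=> /tendsP h; apply/tendscP => e /h; apply: filterS => x.
by rewrite -rmorphB normcR.
Qed.

Lemma tends_normc_le (T : Type) (F : set_system T) {FF : ProperFilter F}
    (u : T -> C) a b e :
  tends F u a -> (\forall x \near F, normc (u x - b) <= e) -> normc (a - b) <= e.
Proof.
move=> /tendscP ua ub; apply/ler_addgt0Pr => d /ua {}ua.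
have [x [h1 h2]] := filter_ex (filterI ua ub).
have -> : a - b = (a - u x) + (u x - b) by rewrite addrA subrK.
rewrite (le_trans (ler_normcD _ _))// addrC lerD// normcB; exact: ltW.
Qed.

End ComplexTends.

(** * Unordered sums: existence, iterated limits, reindexing *)

Section UnorderedSums.
Variable I : choiceType.
Notation totally := (@summability.totally I).
Notation psum := (@summability.partial_sum I _).
Local Open Scope fset_scope.
Local Open Scope ring_scope.

#[local] Existing Instance summability.totally_filter.

Lemma psumE (V : zmodType) (f : I -> V) A : psum f A = \sum_(i <- A) f i.
Proof. by rewrite /summability.partial_sum big_seq_fsetE. Qed.

Lemma near_totally (P : {fset I} -> Prop) :
  (\forall A \near totally, P A) <-> exists A, forall B, A `<=` B -> P B.
Proof. by split=> [[A _ h]|[A h]]; exists A => // B; apply: h. Qed.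

Lemma big_fset_subset (R : numDomainType) (f : I -> R) (A B : {fset I}) :
  (forall i, 0 <= f i) -> A `<=` B ->
  \sum_(i <- A) f i <= \sum_(i <- B) f i.
Proof.
move=> f0 AB; rewrite (big_fsetID _ (mem A) B)/=.
have -> : [fset x in B | x \in A] = A.
  by apply/fsetP => x; rewrite !inE andb_idl//; apply: (fsubsetP AB).
by rewrite lerDl sumr_ge0.
Qed.

(** The limit is the supremum of the finite sums, which increase with the finite set. *)
Lemma tends_psum_ge0 (R : realType) (f : I -> R) (M : R) :
  (forall i, 0 <= f i) -> (forall A : {fset I}, \sum_(i <- A) f i <= M) ->
  exists S, tends totally (psum f) S.
Proof.
move=> f0 fM; pose E := [set x | exists A : {fset I}, x = \sum_(i <- A) f i].
have hE : has_sup E.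
  split; first by exists (\sum_(i <- fset0) f i), fset0.
  by exists M => x [A ->].
exists (sup E); apply/tendsP => e e0; apply/near_totally.
have [x [A ->] hA] := sup_adherent e0 hE.
exists A => B AB; rewrite psumE distrC ger0_norm.
  by have := big_fset_subset f0 AB; lra.
by rewrite subr_ge0; apply: ub_le_sup; [case: hE|exists B].
Qed.

(** [f = (f + g) - g] is a difference of two nonnegative families with bounded finite sums. *)
Lemma tends_psum_real (R : realType) (f g : I -> R) (M : R) :
  (forall i, `|f i| <= g i) -> (forall A : {fset I}, \sum_(i <- A) g i <= M) ->
  exists S, tends totally (psum f) S.
Proof.
move=> fg gM.
have [S1 h1] : exists S, tends totally (psum (fun i => f i + g i)) S.
  apply: (@tends_psum_ge0 _ _ (M + M)) => [i|A].
    by have := fg i; rewrite ler_norml; lra.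
  rewrite big_split lerD// (le_trans _ (gM A))// ler_sum// => i _.
  by have := fg i; rewrite ler_norml; lra.
have [S2 h2] : exists S, tends totally (psum g) S.
  by apply: (@tends_psum_ge0 _ _ M) => // i; apply: le_trans (fg i).
exists (S1 - S2); apply: eq_tends (tendsB h1 h2) => A.
by rewrite !psumE -sumrB; apply: eq_bigr => i _; rewrite addrK.
Qed.

Variable R : realType.
Local Notation C := R[i].
Implicit Types (f : I -> C).

Lemma tends_psum_complex f (g : I -> R) (M : R) :
  (forall i, normc (f i) <= g i) ->
  (forall A : {fset I}, \sum_(i <- A) g i <= M) ->
  exists S, tends totally (psum f) S.
Proof.
move=> fg gM.
have [a ha] : exists a, tends totally (psum (fun i => complex.Re (f i))) a.
  by apply: tends_psum_real gM => i; apply: le_trans (Re_le_normc _) (fg i).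
have [b hb] : exists a, tends totally (psum (fun i => complex.Im (f i))) a.
  by apply: tends_psum_real gM => i; apply: le_trans (Im_le_normc _) (fg i).
exists (a%:C + 'i%C * b%:C).
refine (eq_tends _ (tendsD (tendsR ha) (tendsZ 'i%C (tendsR hb)))) => A.
rewrite !psumE !rmorph_sum/= mulr_sumr -big_split; apply: eq_bigr => i _.
exact: (esym (complexE (f i))).
Qed.

(* A majorant is needed only off a finite set, and its partial sums need only
   be bounded along an exhausting sequence. *)
Lemma tends_psum_majorant f (g : I -> R) (M : R) (A0 : {fset I})
    (s : nat -> seq I) :
  (forall i, 0 <= g i) -> (forall i, i \notin A0 -> normc (f i) <= g i) ->
  (forall n, uniq (s n)) ->
  (forall i, exists N, forall n, (N <= n)%N -> i \in s n) ->
  (forall n, \sum_(i <- s n) g i <= M) ->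
  exists S, tends totally (psum f) S.
Proof.
move=> g0 fg us sI sM.
have fin (r : seq I) : exists N, forall n, (N <= n)%N -> {subset r <= s n}.
  elim: r => [|i r [N hN]]; first by exists 0%N.
  have [N' hN'] := sI i; exists (maxn N N') => n; rewrite geq_max.
  by case/andP=> /hN Nn /hN' ? j; rewrite inE => /predU1P[->//|/Nn].
have gM (A : {fset I}) : \sum_(i <- A) g i <= M.
  have [n /(_ _ (leqnn n)) hn] := fin A; apply: le_trans (sM n).
  have -> : \sum_(i <- s n) g i = \sum_(i <- [fset i in s n]) g i.
    rewrite -[in LHS](undup_id (us n)); apply: perm_big.
    by apply: uniq_perm; rewrite ?undup_uniq// => x; rewrite mem_undup inE.
  by apply: big_fset_subset => //; apply/fsubsetP => x /hn; rewrite inE.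
apply: (@tends_psum_complex _ (fun i => (if i \in A0 then normc (f i) else 0) + g i)
  (\sum_(i <- A0) normc (f i) + M)) => [i|A].
  by case: ifPn => [_|/fg]; rewrite ?lerDl// add0r.
rewrite big_split/= lerD// -big_mkcond/=.
rewrite -big_filter (_ : \sum_(i <- _) _ = \sum_(i <- A `&` A0) normc (f i)).
  apply: big_fset_subset => [i|]; [exact: normc_ge0|exact: fsubsetIr].
apply: perm_big; apply: uniq_perm; rewrite ?filter_uniq ?fset_uniq// => x.
by rewrite mem_filter !inE andbC.
Qed.

(** Some finite set [A] puts every larger finite sum within [e / 2] of [S]. For [N] large, and then
    [M] large depending on [N], the box [s N M] contains [A]; letting [M] grow keeps [r N] within
    [e / 2] of [S]. This licenses summation row by row. *)
Lemma tends_psum_iterated f S (s : nat -> nat -> seq I) (r : nat -> C) :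
  tends totally (psum f) S ->
  (forall N M, uniq (s N M)) ->
  (forall i, exists N0, forall N, (N0 <= N)%N ->
     exists M0, forall M, (M0 <= M)%N -> i \in s N M) ->
  (forall N, tends \oo (fun M => \sum_(i <- s N M) f i) (r N)) ->
  tends \oo r S.
Proof.
move=> fS us sI sr; apply/tendsc_ooP => e e0.
have e20 : 0 < e / 2 by rewrite divr_gt0.
move/tendscP: fS => /(_ _ e20) /near_totally[A hA].
have fin (q : seq I) : exists N0, forall N, (N0 <= N)%N ->
    exists M0, forall M, (M0 <= M)%N -> {subset q <= s N M}.
  elim: q => [|i q [N hN]].
    by exists 0%N => n _; exists 0%N.
  have [N' hN'] := sI i; exists (maxn N N') => n; rewrite geq_max.
  case/andP=> /hN[M hM] /hN'[M' hM']; exists (maxn M M') => m.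
  rewrite geq_max => /andP[/hM Mm /hM' ?] j; rewrite inE.
  by move=> /predU1P[->//|/Mm].
have [N0 hN0] := fin A; exists N0 => N /hN0[M0 hM0].
apply: le_lt_trans (_ : e / 2 < e); last by lra.
apply: tends_normc_le (sr N) _; exists M0 => // M /= /hM0 sub.
have -> : \sum_(i <- s N M) f i = psum f [fset i in s N M].
  rewrite psumE -[in LHS](undup_id (us N M)); apply: perm_big.
  by apply: uniq_perm; rewrite ?undup_uniq// => x; rewrite mem_undup inE.
by apply/ltW/hA/fsubsetP => x /sub; rewrite inE.
Qed.

Lemma tends_psum_exhaust f S (s : nat -> seq I) :
  tends totally (psum f) S ->
  (forall N, uniq (s N)) ->
  (forall i, exists N0, forall N, (N0 <= N)%N -> i \in s N) ->
  tends \oo (fun N => \sum_(i <- s N) f i) S.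
Proof.
move=> fS us sI; apply: (tends_psum_iterated (s := fun N _ => s N) fS).
- by move=> N _; apply: us.
- by move=> i; have [N0 hN0] := sI i; exists N0 => N /hN0 ?; exists 0%N.
- by move=> N; apply: tends_cst.
Qed.

End UnorderedSums.

(** A finite set of indices in [I] contributes only through its preimage, computed with a partial
    inverse [psi] of [phi]. It serves twice: to index lattice points by pairs of integers, and to
    rescale the lattice. *)
Lemma tends_psum_inj (R : realType) (I J : choiceType) (phi : J -> I)
    (f : I -> R[i]) (S : R[i]) :
  injective phi -> (forall i, (forall j, i <> phi j) -> f i = 0) ->
  tends (@summability.totally J) (summability.partial_sum (f \o phi)) S ->
  tends (@summability.totally I) (summability.partial_sum f) S.
Proof.
move=> inj f0 h; have FI := @summability.totally_filter I.
have FJ := @summability.totally_filter J.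
apply/tendscP => e e0; move/tendscP: h => /(_ e e0) /near_totally[A hA].
apply/near_totally; exists (phi @` A)%fset => B AB.
have [psi psiP] : {psi : I -> option J &
    forall i, if psi i is Some j then i = phi j else forall j, i <> phi j}.
  apply: (choice (P := fun i (o : option J) =>
    if o is Some j then i = phi j else forall j, i <> phi j)) => i.
  have [[j ij]|ni] := pselect (exists j, i = phi j); first by exists (Some j).
  by exists None => j ij; apply: ni; exists j.
have phiK j : psi (phi j) = Some j.
  by have := psiP (phi j); case: (psi _) => [k /inj ->//|/(_ j)].
pose Bj := [fset j in pmap psi B]%fset.
have -> : summability.partial_sum f B = summability.partial_sum (f \o phi) Bj.
  rewrite !psumE (bigID (fun i => isSome (psi i)))/= [X in _ + X]big1 ?addr0.
    rewrite -big_filter -(big_map phi xpredT); apply: perm_big.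
    apply: uniq_perm; rewrite ?filter_uniq ?map_inj_uniq ?fset_uniq// => i.
    rewrite mem_filter; apply/andP/mapP => [[]|[j]].
      case E : (psi i) => [j|]// _ iB; exists j; last by have := psiP i; rewrite E.
      by rewrite inE mem_pmap -E map_f.
    rewrite inE mem_pmap => /mapP[i' i'B ji'] ->; rewrite phiK; split=> //.
    by have := psiP i'; rewrite -ji' => <-.
  by move=> i; have := psiP i; case: (psi i) => // /f0.
apply: hA; apply/fsubsetP => j jA; rewrite inE mem_pmap.
apply/mapP; exists (phi j); last by rewrite phiK.
by apply: (fsubsetP AB); apply: in_imfset.
Qed.

(** * Estimates for the exponential *)

Section RealTrigonometry.
Variable R : realType.
Implicit Types (t x : R).

Lemma sin_mean_value t : exists2 c, `|c| <= `|t| & sin t = cos c * t.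
Proof.
wlog t0 : t / 0 <= t => [hw|].
  have [/hw//|t0] := leP 0 t; have /hw[c ct sc] : 0 <= - t by lra.
  by exists c; [rewrite -(normrN t)|apply: oppr_inj; rewrite -sinN sc mulrN].
have [|c] := @MVT_segment R sin cos 0 t t0.
  by apply: continuous_subspaceT; apply: continuous_sin.
rewrite in_itv/= !subr0 sin0 subr0 => /andP[c0 ct] ->.
by exists c => //; rewrite !ger0_norm.
Qed.

Lemma norm_sin_le t : `|sin t| <= `|t|.
Proof.
have [c _ ->] := sin_mean_value t.
by rewrite normrM ler_piMl ?cos_max.
Qed.

Lemma cos_ge t : 1 - t ^+ 2 / 2 <= cos t.
Proof.
have -> : cos t = 1 - 2 * sin (t / 2) ^+ 2.
  have tE : t = (t / 2) *+ 2 by rewrite mulr2n; lra.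
  by rewrite [in LHS]tE cos_mulr2n cos2sin2; ring.
have : sin (t / 2) ^+ 2 <= (t / 2) ^+ 2.
  rewrite -(real_normK (num_real (sin _))) -(real_normK (num_real (t / 2))).
  by rewrite ler_pXn2r ?nnegrE// norm_sin_le.
nra.
Qed.

Lemma norm_sinB_le t : `|t| <= 1 -> `|sin t - t| <= t ^+ 2.
Proof.
move=> t1; have [c ct ->] := sin_mean_value t.
rewrite -[X in _ - X]mul1r -mulrBl normrM -(real_normK (num_real t)) expr2.
rewrite ler_wpM2r// ler_norml.
have := cos_ge c; have := cos_le1 c; have := normr_ge0 t.
rewrite -(real_normK (num_real c)); have := normr_ge0 c; nra.
Qed.

(** Halving the angle brings [pi x] into [|t| <= 3 pi / 8], where the cosine is at least
    [c = cos(3 pi / 8) > 0]; the two factors of [2 sin(t) cos(t)] give [c^2]. The range [3 / 4]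
    instead of [1 / 2] leaves room for the shift by [z] in [csinpi_scaled_ge]. *)
Lemma norm_sin_ge : exists2 k : R, 0 < k <= 1 &
  forall x, `|x| <= 3 / 4 -> k * `|x| <= `|sin (pi * x)|.
Proof.
have pi0 := @pi_gt0 R; have pi2 := @pi_ge2 R.
pose c : R := cos (pi * (3 / 8)).
have c0 : 0 < c by apply: cos_gt0_pihalf; nra.
exists (c ^+ 2).
  by rewrite exprn_gt0//= -(expr1n _ 2) ler_pXn2r ?nnegrE ?cos_le1// ltW.
move=> x x34.
have cle t : `|t| <= pi * (3 / 8) -> c <= cos t.
  move=> tle; rewrite -(cos_norm t); have [->//|ne] := eqVneq `|t| (pi * (3/8)).
  apply: ltW; rewrite ltr_cos ?in_itv/= ?normr_ge0/= ?lt_neqAle ?ne//; nra.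
have hx : `|pi * x / 2| <= pi * (3 / 8).
  by rewrite !normrM (gtr0_norm pi0) (gtr0_norm (_ : 0 < 2^-1))//; nra.
have -> : pi * x = (pi * x / 2) *+ 2 by rewrite mulr2n; lra.
rewrite sin_mulr2n normrMn normrM.
have h1 : c <= `|cos (pi * x / 2)| by apply: le_trans (cle _ hx) (ler_norm _).
have h2 : c * `|x| <= `|sin (pi * x / 2)|.
  have [d dx ->] := sin_mean_value (pi * x / 2).
  rewrite normrM ler_pM ?(ltW c0)//.
    by apply: le_trans (cle _ (le_trans dx hx)) (ler_norm _).
  rewrite !normrM (gtr0_norm pi0) (gtr0_norm (_ : 0 < 2^-1))//.
  have := normr_ge0 x; nra.
have : c * (c * `|x|) <= `|cos (pi * x / 2)| * `|sin (pi * x / 2)|.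
  by rewrite ler_pM ?mulr_ge0 ?(ltW c0).
rewrite mulrA -expr2 mulr2n => /le_trans; apply.
by rewrite lerDl mulr_ge0.
Qed.

(** Only [1 + t <= exp t] is used: at [t = x] for the lower bound, and at [t = - x] for
    [exp x <= 1 / (1 - x)], so that the error is at most [x^2 / (1 - x)]. *)
Lemma norm_expRB1_le x : `|x| <= 1 / 2 -> `|expR x - 1 - x| <= 2 * x ^+ 2.
Proof.
rewrite !ler_norml => /andP[x1 x2]; have h := expR_ge1Dx x.
have h2 := expR_ge1Dx (- x); have h3 := expRxMexpNx_1 x.
have e0 := expR_gt0 x.
have : expR x * (1 - x) <= expR x * expR (- x) by rewrite ler_pM2l.
rewrite h3.
nra.
Qed.

Lemma norm_sinh_ge x : `|x| <= `|expR x - expR (- x)|.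
Proof.
wlog x0 : x / 0 <= x => [hw|].
  have [/hw//|x0] := leP 0 x; have /hw : 0 <= - x by lra.
  by rewrite opprK normrN distrC.
have h := expR_ge1Dx x; have : expR (- x) <= 1 by rewrite expR_le1; lra.
by move=> ?; rewrite !ger0_norm; lra.
Qed.

End RealTrigonometry.

Section ComplexExponential.
Variable R : realType.
Local Notation C := R[i].
Implicit Types (z w : C) (n : nat).

Lemma cexpD z w : cexp (z + w) = cexp z * cexp w.
Proof.
case: z w => a b [c d]; rewrite /cexp /= expRD cosD sinD.
apply/eqP; rewrite eq_complex /= !mul0r !subr0 !addr0.
by apply/andP; split; apply/eqP; ring.
Qed.

Lemma cexp0 : cexp (0 : C) = 1.
Proof. by rewrite /cexp /= expR0 cos0 sin0 mul1r. Qed.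

Lemma normc_cexp z : normc (cexp z) = expR (complex.Re z).
Proof.
rewrite /cexp normcM normcR /= cos2Dsin2 sqrtr1 mulr1.
by rewrite ger0_norm// expR_ge0.
Qed.

Lemma cexp_neq0 z : cexp z != 0.
Proof. by rewrite -normc_gt0 normc_cexp expR_gt0. Qed.

Lemma cexpN z : cexp (- z) = (cexp z)^-1.
Proof.
by apply: (mulfI (cexp_neq0 z)); rewrite -cexpD subrr cexp0 mulfV ?cexp_neq0.
Qed.

Lemma cexpM_nat n z : cexp (n%:R * z) = cexp z ^+ n.
Proof.
elim: n => [|n IHn]; first by rewrite mul0r cexp0.
by rewrite -natr1 mulrDl mul1r cexpD IHn exprSr.
Qed.

(** With [z = a + i b], the real part of the error is at most [2 a^2 + b^2] and the imaginary part
    at most [4 a^2 + 8 b^2], whence the crude [10]; only the quadratic order matters later. *)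
Lemma normc_cexpB1_le z :
  normc z <= 1 / 2 -> normc (cexp z - 1 - z) <= 10 * normc z ^+ 2.
Proof.
move=> z12; have ha := le_trans (Re_le_normc z) z12.
have hb := le_trans (Im_le_normc z) z12.
rewrite normc_sqr; apply: le_trans (normc_le_ReIm _) _.
case: z ha hb {z12} => a b /= ha hb; rewrite !mul0r !subr0 !addr0.
have e1 := norm_expRB1_le ha.
have e2 : `|sin b - b| <= b ^+ 2 by apply: norm_sinB_le; lra.
have e3 := cos_ge b; have e4 := cos_le1 b.
move: ha hb e1 e2; rewrite !ler_norml => /andP[? ?] /andP[? ?] /andP[? ?] /andP[? ?].
have ea : expR a <= 2 by nra.
have ea0 := expR_gt0 a.
have h1 : `|expR a * cos b - 1 - a| <= 2 * a ^+ 2 + b ^+ 2.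
  have -> : expR a * cos b - 1 - a = (expR a - 1 - a) - expR a * (1 - cos b) by ring.
  have h : 0 <= expR a * (1 - cos b) <= 2 * (b ^+ 2 / 2) by nra.
  by rewrite ler_norml; lra.
have h2 : `|expR a * sin b - b| <= 4 * a ^+ 2 + 8 * b ^+ 2.
  have -> : expR a * sin b - b = expR a * (sin b - b) + (expR a - 1) * b by ring.
  have h : - (2 * b ^+ 2) <= expR a * (sin b - b) <= 2 * b ^+ 2 by nra.
  have h' : `|(expR a - 1) * b| <= 2 * `|a| * `|b|.
    rewrite normrM ler_wpM2r// ler_norml; case: (ger0P a) => ?; nra.
  have h3 : 2 * `|a| * `|b| <= a ^+ 2 + b ^+ 2.
    rewrite -(real_normK (num_real a)) -(real_normK (num_real b)).
    have := sqr_ge0 (`|a| - `|b|); nra.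
  move: h'; rewrite !ler_norml; have := sqr_ge0 a; have := sqr_ge0 b; lra.
have := sqr_ge0 a; have := sqr_ge0 b; lra.
Qed.

End ComplexExponential.

(** * Partial fractions of the cotangent and the squared cosecant *)

Section SinPi.
Variable R : realType.
Local Notation C := R[i].
Implicit Types (z w v : C) (n k : nat).

Definition ipi : C := 'i%C * (@pi R)%:C.

Definition csinpi z : C := (cexp (ipi * z) - cexp (- (ipi * z))) / (2 * 'i%C).

Definition ccospi z : C := (cexp (ipi * z) + cexp (- (ipi * z))) / 2.

Lemma i_neq0 : 'i%C != 0 :> C.
Proof. by rewrite eq_complex /= oner_eq0 andbF. Qed.

Lemma mul_iR (x : R) : 'i%C * x%:C = 0 +i* x.
Proof. by apply/eqP; rewrite eq_complex /= !(mul0r, mulr0) subr0 add0r mul1r !eqxx. Qed.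

Lemma pi_neq0 : (@pi R)%:C != 0.
Proof. by rewrite eq_complex /= gt_eqF// pi_gt0. Qed.

Lemma csinpiD z w : csinpi (z + w) = csinpi z * ccospi w + ccospi z * csinpi w.
Proof.
rewrite /csinpi /ccospi mulrDr opprD !cexpD.
by field; rewrite i_neq0.
Qed.

Lemma ccospiD z w : ccospi (z + w) = ccospi z * ccospi w - csinpi z * csinpi w.
Proof.
rewrite /csinpi /ccospi mulrDr opprD !cexpD.
apply: (@mulfI _ (4 * 'i%C ^+ 2)); first by rewrite sqr_i mulf_neq0// oppr_eq0 oner_eq0.
have -> : 4 * 'i%C ^+ 2 * ((cexp (ipi * z) + cexp (- (ipi * z))) / 2 *
   ((cexp (ipi * w) + cexp (- (ipi * w))) / 2) -
   (cexp (ipi * z) - cexp (- (ipi * z))) / (2 * 'i%C) *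
   ((cexp (ipi * w) - cexp (- (ipi * w))) / (2 * 'i%C))) =
   'i%C ^+ 2 * (cexp (ipi * z) + cexp (- (ipi * z))) * (cexp (ipi * w) + cexp (- (ipi * w))) -
   (cexp (ipi * z) - cexp (- (ipi * z))) * (cexp (ipi * w) - cexp (- (ipi * w))).
  by field; rewrite i_neq0.
by rewrite sqr_i; field.
Qed.

Lemma csinpiN z : csinpi (- z) = - csinpi z.
Proof. by rewrite /csinpi mulrN opprK -[RHS]mulNr opprB. Qed.

Lemma ccospiN z : ccospi (- z) = ccospi z.
Proof. by rewrite /ccospi mulrN opprK addrC. Qed.

Lemma cexp_ipi_half : cexp (ipi / 2) = 'i%C.
Proof.
have -> : ipi / 2 = 0 +i* (pi / 2).
  by rewrite -mul_iR rmorphM fmorphV rmorph_nat mulrA.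
by rewrite /cexp /= expR0 mul1r cos_pihalf sin_pihalf.
Qed.

Lemma csinpi_half : csinpi 2^-1 = 1.
Proof.
rewrite /csinpi cexpN cexp_ipi_half.
have -> : ('i%C)^-1 = - 'i%C :> C.
  by apply: (mulfI i_neq0); rewrite mulfV ?i_neq0// mulrN -expr2 sqr_i opprK.
by rewrite opprK -mulr2n -[_ *+ 2]mulr_natl divff// mulf_neq0 ?i_neq0.
Qed.

Lemma ccospi_half : ccospi 2^-1 = 0.
Proof.
rewrite /ccospi cexpN cexp_ipi_half.
have -> : ('i%C)^-1 = - 'i%C :> C.
  by apply: (mulfI i_neq0); rewrite mulfV ?i_neq0// mulrN -expr2 sqr_i opprK.
by rewrite subrr mul0r.
Qed.

Lemma half_add_half : 2^-1 + 2^-1 = 1 :> C.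
Proof. by field. Qed.

Lemma csinpiD1 z : csinpi (z + 1) = - csinpi z.
Proof.
by rewrite -half_add_half addrA !(csinpiD, ccospiD) csinpi_half ccospi_half; ring.
Qed.

Lemma ccospiD1 z : ccospi (z + 1) = - ccospi z.
Proof.
by rewrite -half_add_half addrA !(csinpiD, ccospiD) csinpi_half ccospi_half; ring.
Qed.

Lemma normc_csinpi_sqr z : normc (csinpi z) ^+ 2 =
  ((expR (pi * complex.Im z) - expR (- (pi * complex.Im z))) / 2) ^+ 2
  + sin (pi * complex.Re z) ^+ 2.
Proof.
set x := complex.Re z; set y := complex.Im z.
have e1 : ipi * z = (- (pi * y)) +i* (pi * x).
  rewrite /ipi mul_iR /x /y; case: (z) => a b; apply/eqP; rewrite eq_complex /=.
  by apply/andP; split; apply/eqP; ring.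
rewrite /csinpi e1 normcM exprMn normcV normcM -[2]/(2%:R) normc_nat.
have -> : normc ('i%C : C) = 1 by rewrite /= expr0n /= add0r expr1n sqrtr1.
rewrite mulr1 normc_sqr /cexp /= opprK cosN sinN.
set q := expR (pi * y); set p := expR (- (pi * y)).
have pq : q * p = 1 by apply: expRxMexpNx_1.
have := cos2Dsin2 (pi * x); set c := cos _; set s := sin _ => cs.
transitivity ((p - q) ^+ 2 * (c ^+ 2 + s ^+ 2) / 4 + (q * p) * s ^+ 2); last first.
  by rewrite cs pq; field.
by field.
Qed.

(** The two squares in [normc_csinpi_sqr] are bounded separately: the hyperbolic sine by
    [pi |y| / 2], the sine by [k |x|]. Since [k <= 1], the constant [k / 2] suits both. *)
Lemma normc_csinpi_ge : exists2 c : R, 0 < c &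
  forall z, `|complex.Re z| <= 3 / 4 -> c * normc z <= normc (csinpi z).
Proof.
have [k /andP[k0 k1] hk] := norm_sin_ge R; exists (k / 2); first by rewrite divr_gt0.
move=> z /hk hz.
rewrite -(@ler_pXn2r _ 2) ?nnegrE ?mulr_ge0 ?normc_ge0 ?divr_ge0 ?(ltW k0)//.
rewrite normc_csinpi_sqr exprMn normc_sqr -(real_normK (num_real (sin _))).
rewrite -(real_normK (num_real (complex.Re z))).
have h := norm_sinh_ge (pi * complex.Im z).
have h2 : (pi * complex.Im z) ^+ 2 <=
   (expR (pi * complex.Im z) - expR (- (pi * complex.Im z))) ^+ 2.
  rewrite -(real_normK (num_real (pi * _))) -(real_normK (num_real (_ - _))).
  by rewrite ler_pXn2r ?nnegrE.
have h3 : (k * `|complex.Re z|) ^+ 2 <= `|sin (pi * complex.Re z)| ^+ 2.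
  by rewrite ler_pXn2r ?nnegrE ?mulr_ge0 ?(ltW k0).
have h4 : k ^+ 2 <= 1 by rewrite -(expr1n _ 2) ler_pXn2r ?nnegrE ?(ltW k0).
have h5 : 1 <= (@pi R) ^+ 2.
  rewrite -(expr1n _ 2) ler_pXn2r ?nnegrE ?pi_ge0//; have := @pi_ge2 R; lra.
rewrite !exprMn in h2 h3 *; set X := `|_| ^+ 2 in h3 *; set Y := complex.Im z ^+ 2 in h2 *.
have X0 : 0 <= X by rewrite exprn_ge0.
have Y0 : 0 <= Y by rewrite exprn_even_ge0.
have Yk : k ^+ 2 * Y <= pi ^+ 2 * Y by rewrite ler_wpM2r// (le_trans h4).
have kX : 0 <= k ^+ 2 * X by rewrite mulr_ge0// exprn_ge0// ltW.
rewrite (_ : (2^-1 : R) ^+ 2 = 4^-1); last by field.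
lra.
Qed.

Definition notint z := forall m : int, z <> m%:~R.

Lemma csinpi_neq0 z : notint z -> csinpi z != 0.
Proof.
move=> nz; have [c c0 hc] := normc_csinpi_ge.
have per (m : nat) w : csinpi (w + m%:R) == 0 -> csinpi w == 0.
  elim: m => [|m IHm]; first by rewrite addr0.
  by rewrite -natr1 addrA csinpiD1 oppr_eq0.
have perz (m : int) w : csinpi (w + m%:~R) == 0 -> csinpi w == 0.
  case: m => m; first exact: per.
  rewrite NegzE intrN => h.
  suff : csinpi (- w) == 0 by rewrite csinpiN oppr_eq0.
  by apply: (per m.+1); rewrite -oppr_eq0 -csinpiN opprD opprK.
apply/negP => sz.
(* Rounding the real part gives [|Re w| <= 1 / 2], inside the strip where the linear lower bound
   allows no zero but [0]. *)
pose m := Num.floor (complex.Re z + 2^-1); pose w := z - m%:~R.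
have /hc : `|complex.Re w| <= 3 / 4.
  have /andP[h1 h2] := floor_itv (complex.Re z + 2^-1).
  have -> : complex.Re w = complex.Re z - m%:~R.
    by rewrite raddfB/= -(rmorph_int (real_complex R)).
  by rewrite ler_norml; move: h1 h2; rewrite -/m intrD; lra.
have -> : csinpi w = 0 by apply/eqP/(perz m); rewrite subrK.
rewrite normc0 pmulr_rle0// => w0.
have : w == 0 by rewrite -normc_eq0 eq_le w0 normc_ge0.
by rewrite subr_eq0 => /eqP/nz.
Qed.

(** The linear parts of the two exponentials give [pi v] exactly; the remainders are [O(4^-n)] and
    still vanish after multiplication by [2^n]. All termwise limits in the partial fractions derive
    from this one. *)
Lemma tends_csinpi_scaled v :
  tends \oo (fun n => 2 ^+ n * csinpi (v / 2 ^+ n)) (pi%:C * v).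
Proof.
pose b := normc (ipi * v).
have [N hN] : exists N, forall n, (N <= n)%N -> b / 2 ^+ n <= 1 / 2.
  have hg : tends \oo (fun n => b * 2^-1 ^+ n) (0 : R) by apply: tends_geometric; lra.
  have [|N hN] := (tends_ooP _ _).1 hg 2^-1; first by [].
  exists N => n /hN; rewrite subr0 exprVn => /ltW/(le_trans (ler_norm _)).
  by rewrite mul1r.
apply: (@tends_squeeze _ N _ (fun n => 10 * b ^+ 2 * 2^-1 ^+ n)); last first.
  by apply: tends_geometric; lra.
move=> n /hN hn; set h := ipi * (v / 2 ^+ n).
have N0 : 2 ^+ n != 0 :> C by rewrite expf_neq0.
have nh : normc h = b / 2 ^+ n.
  by rewrite /h mulrA normcM normcV normcX normc_nat.
have -> : 2 ^+ n * csinpi (v / 2 ^+ n) - pi%:C * v =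
    2 ^+ n / (2 * 'i%C) * ((cexp h - 1 - h) - (cexp (- h) - 1 - - h)).
  rewrite /csinpi -/h (_ : pi%:C * v = 2 ^+ n * h / 'i%C); last first.
    by rewrite /h /ipi; field; rewrite i_neq0 N0.
  by field; rewrite i_neq0.
rewrite normcM normcM normcV normcM normcX !normc_nat.
have -> : normc ('i%C : C) = 1 by rewrite /= expr0n /= add0r expr1n sqrtr1.
have h1 : normc h <= 1 / 2 by rewrite nh.
have h2 : normc (- h) <= 1 / 2 by rewrite normcN.
have := normc_cexpB1_le h1; have := normc_cexpB1_le h2; rewrite normcN.
have := ler_normcD (cexp h - 1 - h) (- (cexp (- h) - 1 - - h)); rewrite normcN.
set X := normc (_ - _); set Y := normc _; set Z := normc _ => t1 t2 t3.
have P0 : 0 < 2 ^+ n :> R by rewrite exprn_gt0.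
have hX : X <= 20 * normc h ^+ 2 by lra.
rewrite mulr1 exprVn.
have {}hX : 2 ^+ n / 2 * X <= 2 ^+ n / 2 * (20 * normc h ^+ 2).
  by rewrite ler_wpM2l// divr_ge0// ltW.
apply: le_trans hX _; rewrite nh le_eqVlt; apply/orP; left; apply/eqP.
by field; rewrite expf_neq0.
Qed.

End SinPi.

Lemma sum_ord_double (V : zmodType) (f : nat -> V) n :
  \sum_(k < n + n) f k = \sum_(k < n) f k + \sum_(k < n) f (n + k)%N.
Proof. by rewrite big_split_ord. Qed.

Section PartialFractions.
Variable R : realType.
Local Notation C := R[i].
Implicit Types (z w v : C) (n k : nat).

(* Dominated convergence for series; the domination is used only for the
   tails, so finitely many indices may escape it. *)
Lemma tannery (a : nat -> nat -> C) (b : nat -> C) (S : C) (M : R) K0 n0 :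
  0 <= M ->
  (forall n, (n0 <= n)%N -> S = \sum_(k < 2 ^ n) a n k) ->
  (forall k, tends \oo (a^~ k) (b k)) ->
  (forall n k, (n0 <= n)%N -> (K0 <= k < 2 ^ n)%N ->
     normc (a n k) <= M / k.+1%:R ^+ 2) ->
  tends \oo (fun K => \sum_(k < K) b k) S.
Proof.
move=> M0 Sa ab aM; apply: (@tends_squeeze _ K0 _ (fun K => (2 * M) / K.+1%:R)); last first.
  exact: tends_harmonic.
move=> K K0K.
have h : tends \oo (fun n => \sum_(k < K) a n k) (\sum_(k < K) b k).
  by apply: (@tends_sum _ _ _ _ _ _ _ (fun (k : 'I_K) n => a n k)).
apply: tends_normc_le h _; exists (maxn n0 K) => // n /=.
rewrite geq_max => /andP[n0n Kn].
have K2 : (K <= 2 ^ n)%N by rewrite (leq_trans Kn)// ltnW// ltn_expl.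
(* Since [S] is represented exactly at stage [n], only the indices from [K] on remain; they add up
   to at most [2 M / (K + 1)], uniformly in [n]. *)
rewrite (Sa _ n0n) -!(big_mkord xpredT (a n)) [X in _ - X](big_cat_nat (n := K))//=.
rewrite opprD addrA subrr add0r normcN; apply: le_trans (ler_normc_sum _ _ _) _.
rewrite -{1}[K]add0n big_addn big_mkord.
have le1 (k : 'I_(2 ^ n - K)) :
    normc (a n (k + K)%N) <= M * ((K.+1%:R + (k : nat)%:R) ^+ 2)^-1.
  have := aM n (k + K)%N n0n; rewrite (leq_trans K0K) ?leq_addl//=.
  rewrite -natrD addSn (addnC K) => /(_ _); apply.
  by have := ltn_ord k; lia.
apply: (@le_trans _ _ (\sum_(k < 2 ^ n - K) M * ((K.+1%:R + (k : nat)%:R) ^+ 2)^-1)).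
  by apply: ler_sum => k _; apply: le1.
rewrite -mulr_sumr.
by rewrite (mulrC 2) -mulrA ler_wpM2l// sum_inv_sqr_le ?ler1n ?ltr0n.
Qed.

(* One duplication step doubles the number of terms; by 1-periodicity the upper
   half of the resulting range is moved to negative indices. *)
Lemma duplication_iter (F : C -> C) (c : C) :
  (forall w, notint w -> F w = c * (F (w / 2) + F ((w + 1) / 2))) ->
  (forall w, F (w + 1) = F w) ->
  forall n z, notint z -> F z = c ^+ n.+1 *
    \sum_(k < 2 ^ n) (F ((z + k%:R) / 2 ^+ n.+1) + F ((z - 1 - k%:R) / 2 ^+ n.+1)).
Proof.
move=> dup per.
have N0 n : 2 ^+ n != 0 :> C by rewrite expf_neq0.
have step n z : notint z ->
    F z = c ^+ n * \sum_(k < 2 ^ n) F ((z + k%:R) / 2 ^+ n).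
  move=> nz; elim: n => [|n IHn].
    by rewrite !expr0 big_ord1 addr0 divr1 mul1r.
  rewrite IHn exprSr -mulrA; congr (_ * _).
  rewrite [in RHS]expnS mul2n -addnn.
  rewrite (sum_ord_double (fun k => F ((z + k%:R) / 2 ^+ n.+1))) -big_split.
  rewrite /= mulr_sumr.
  apply: eq_bigr => k _; rewrite dup.
    congr (c * (F _ + F _)); first by rewrite exprS; field; rewrite N0.
    by rewrite natrD natrX exprS; field; rewrite N0.
  move=> m e; apply: (nz (m * (2 ^ n)%N%:Z - (k : nat)%:Z)).
  by rewrite intrB intrM -!pmulrn natrX -e divfK// addrK.
move=> n z nz; rewrite (step n.+1)// expnS mul2n -addnn.
rewrite (sum_ord_double (fun k => F ((z + k%:R) / 2 ^+ n.+1))) big_split.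
rewrite /=; congr (_ * (_ + _)).
rewrite (reindex_inj rev_ord_inj)/=; apply: eq_bigr => k _.
rewrite -[RHS]per; congr F; rewrite addnBA ?ltn_ord// natrB; last first.
  by rewrite (leq_trans (ltn_ord k))// leq_addr.
by rewrite natrD natrX -(natr1 k) exprS; field; rewrite N0.
Qed.

Definition pcot z : C := pi%:C * ccospi z / csinpi z.

Definition pcsc2 z : C := (pi%:C / csinpi z) ^+ 2.

Lemma pcotD1 z : pcot (z + 1) = pcot z.
Proof. by rewrite /pcot csinpiD1 ccospiD1 mulrN mulNr invrN mulrN opprK. Qed.

Lemma pcsc2D1 z : pcsc2 (z + 1) = pcsc2 z.
Proof. by rewrite /pcsc2 csinpiD1 invrN mulrN sqrrN. Qed.

Lemma pcotN z : pcot (- z) = - pcot z.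
Proof. by rewrite /pcot csinpiN ccospiN invrN mulrN. Qed.

Lemma pcsc2N z : pcsc2 (- z) = pcsc2 z.
Proof. by rewrite /pcsc2 csinpiN invrN mulrN sqrrN. Qed.

Lemma csinpi_double z : csinpi z = 2 * csinpi (z / 2) * ccospi (z / 2).
Proof. by rewrite {1}(_ : z = z / 2 + z / 2) ?csinpiD; [ring|field]. Qed.

Lemma ccospi_double z : ccospi z = ccospi (z / 2) ^+ 2 - csinpi (z / 2) ^+ 2.
Proof. by rewrite {1}(_ : z = z / 2 + z / 2) ?ccospiD; [ring|field]. Qed.

Lemma csinpi_shift_half z : csinpi ((z + 1) / 2) = ccospi (z / 2).
Proof. by rewrite mulrDl mul1r csinpiD csinpi_half ccospi_half; ring. Qed.

Lemma ccospi_shift_half z : ccospi ((z + 1) / 2) = - csinpi (z / 2).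
Proof. by rewrite mulrDl mul1r ccospiD csinpi_half ccospi_half; ring. Qed.

Lemma pcot_duplication z : notint z ->
  pcot z = 2^-1 * (pcot (z / 2) + pcot ((z + 1) / 2)).
Proof.
move=> /csinpi_neq0; rewrite /pcot csinpi_shift_half ccospi_shift_half.
rewrite (csinpi_double z) (ccospi_double z).
move: (csinpi (z / 2)) (ccospi (z / 2)) => s c; rewrite !mulf_eq0 !negb_or => /andP[/andP[_ s0] c0].
by field; rewrite s0 c0.
Qed.

Lemma csinpi2Dccospi2 z : csinpi z ^+ 2 + ccospi z ^+ 2 = 1.
Proof.
have h : ccospi (z - z) = 1.
  by rewrite subrr /ccospi mulr0 oppr0 cexp0 -mulr2n divff.
by rewrite -h ccospiD ccospiN csinpiN; ring.
Qed.

(** With [s], [c] the sine and cosine at half the argument, [1 / s^2 + 1 / c^2 = 1 / (s c)^2],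
    because [s^2 + c^2 = 1]. *)
Lemma pcsc2_duplication z : notint z ->
  pcsc2 z = 4^-1 * (pcsc2 (z / 2) + pcsc2 ((z + 1) / 2)).
Proof.
move=> /csinpi_neq0; rewrite /pcsc2 csinpi_shift_half.
rewrite (csinpi_double z); have := csinpi2Dccospi2 (z / 2).
move: (csinpi (z / 2)) (ccospi (z / 2)) => s c sc1.
rewrite !mulf_eq0 !negb_or => /andP[/andP[_ s0] c0].
transitivity (pi%:C ^+ 2 * (s ^+ 2 + c ^+ 2) / (2 * s * c) ^+ 2).
  by rewrite sc1 mulr1 expr_div_n.
by field; rewrite s0 c0.
Qed.

Lemma exprV4 n : 4^-1 ^+ n = ((2 ^+ n)^-1) ^+ 2 :> C.
Proof.
rewrite -exprVn -exprM mulnC exprM (_ : 4^-1 = 2^-1 ^+ 2 :> C)//.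
by field.
Qed.

Lemma tends_pcsc2_scaled v : v != 0 ->
  tends \oo (fun n => 4^-1 ^+ n.+1 * pcsc2 (v / 2 ^+ n.+1)) (v ^+ 2)^-1.
Proof.
move=> v0; have h := @tends_csinpi_scaled R v.
have pv0 : pi%:C * v != 0 by rewrite mulf_neq0 ?pi_neq0.
have -> : (v ^+ 2)^-1 = (pi%:C / (pi%:C * v)) ^+ 2.
  by move: (pi%:C) (pi_neq0 R) => p p0; field; rewrite v0 p0.
refine (@tends_comp_nat _ S (fun n => 4^-1 ^+ n * pcsc2 (v / 2 ^+ n)) _ leqnSn _).
refine (eq_tends _ (tendsX 2 (tendsZ pi%:C (tendsV pv0 h)))) => n.
by rewrite /pcsc2 exprV4 -exprMn invfM mulrCA.
Qed.

Lemma tends_scaled0 v : tends \oo (fun n => v / 2 ^+ n) 0.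
Proof.
apply: (@tends_squeeze _ 0 _ (fun n => normc v * 2^-1 ^+ n)).
  by move=> n _; rewrite subr0 normcM normcV normcX normc_nat exprVn.
by apply: tends_geometric; lra.
Qed.

(** [cos(2 x) = 1 - 2 sin(x)^2] reduces this to the sine, so no separate estimate is needed. *)
Lemma tends_ccospi_scaled v : tends \oo (fun n => ccospi (v / 2 ^+ n)) 1.
Proof.
have h : tends \oo (fun n => csinpi (v / 2 / 2 ^+ n)) 0.
  rewrite -[X in tends _ _ X](mulr0 (pi%:C * (v / 2))).
  refine (eq_tends _ (tendsM (@tends_csinpi_scaled R (v / 2)) (@tends_scaled0 1))) => n.
  by rewrite mul1r mulrAC divff ?mul1r// expf_neq0.
have e : 1 - 2 * 0 ^+ 2 = 1 :> C by rewrite expr0n mulr0 subr0.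
rewrite -[X in tends _ _ X]e.
refine (eq_tends _ (tendsB (tends_cst (1 : C)) (tendsZ 2 (tendsX 2 h)))) => n.
rewrite [in RHS](splitr v) (mulrDl (v / 2)) ccospiD; have := csinpi2Dccospi2 (v / 2 / 2 ^+ n).
move: (csinpi _) (ccospi _) => s c sc1.
have -> : c * c = 1 - s ^+ 2 by rewrite -sc1 addrAC subrr add0r expr2.
by ring.
Qed.

Lemma tends_pcot_scaled v : v != 0 ->
  tends \oo (fun n => 2^-1 ^+ n.+1 * pcot (v / 2 ^+ n.+1)) v^-1.
Proof.
move=> v0; have h := @tends_csinpi_scaled R v.
have pv0 : pi%:C * v != 0 by rewrite mulf_neq0 ?pi_neq0.
have -> : v^-1 = pi%:C * 1 / (pi%:C * v).
  by move: (pi%:C) (pi_neq0 R) => p p0; field; rewrite v0 p0.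
refine (@tends_comp_nat _ S (fun n => 2^-1 ^+ n * pcot (v / 2 ^+ n)) _ leqnSn _).
refine (eq_tends _ (tendsM (tendsZ pi%:C (@tends_ccospi_scaled v)) (tendsV pv0 h))) => n.
by rewrite /pcot invfM mulrCA exprVn.
Qed.

(** Let [w] be [z + k] or [z - 1 - k], and [|z| <= m]. The condition [k >= 2 m + 1] is exactly
    [k - m >= (k + 1) / 2], so [|w| >= (k + 1) / 2]. The choice of [n0] makes [m] small against
    [2^n]; as [k < 2^n], the scaled argument stays in the strip [|Re| <= 3 / 4] of
    [normc_csinpi_ge]. *)
Lemma csinpi_scaled_ge z : exists c K0 n0, [/\ 0 < c :> R &
  forall n k, (n0 <= n)%N -> (K0 <= k < 2 ^ n)%N ->
   c * k.+1%:R <= normc (2 ^+ n.+1 * csinpi ((z + k%:R) / 2 ^+ n.+1)) /\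
   c * k.+1%:R <= normc (2 ^+ n.+1 * csinpi ((z - 1 - k%:R) / 2 ^+ n.+1))].
Proof.
have [c c0 hc] := normc_csinpi_ge R.
pose m := (Num.truncn (normc z)).+1.
have zm : normc z <= m%:R by apply/ltW/truncnS_gt.
exists (c / 2), (2 * m).+1, (4 * (m + 2))%N; split; first by rewrite divr_gt0.
move=> n k n0n /andP[K0k k2n].
have n2n : (n <= 2 ^ n)%N by rewrite ltnW// ltn_expl.
have P0 : 0 < 2 ^+ n.+1 :> R by rewrite exprn_gt0.
have P0' : 2 ^+ n.+1 != 0 :> C by rewrite expf_neq0.
have hP : 2 ^+ n.+1 = 2 * (2 ^ n)%:R :> R by rewrite exprS natrX.
have mn : 4 * (m%:R + 2) <= (2 ^ n)%:R :> R.
  by rewrite -[2]/(2%:R) -natrD -natrM ler_nat (leq_trans n0n).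
have kn : k%:R + 1 <= (2 ^ n)%:R :> R by rewrite natr1 ler_nat.
have mk : 2 * m%:R + 1 <= k%:R :> R by rewrite -natrM natr1 ler_nat.
have kE : k%:R + 1 - z = - (z - 1 - k%:R) by ring.
have t1 := ler_normcD z k%:R; have t2 := ler_normcD (k%:R + 1) (- z).
have t3 := ler_normc_sub k%:R (- z); have t4 := ler_normc_sub (k%:R + 1) z.
rewrite opprK (addrC _ z) normcN in t3.
rewrite natr1 !normc_nat -(natr1 k) normcN in t1 t2 t3 t4.
rewrite kE normcN in t2 t4.
suff H w : normc w <= m%:R + k%:R + 1 -> (k%:R + 1) / 2 <= normc w ->
    c / 2 * k.+1%:R <= normc (2 ^+ n.+1 * csinpi (w / 2 ^+ n.+1)).
  by split; apply: H; lra.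
move=> w1 w2; rewrite normcM normcX normc_nat.
have /hc : `|complex.Re (w / 2 ^+ n.+1)| <= 3 / 4.
  apply: le_trans (Re_le_normc _) _.
  rewrite normcM normcV normcX normc_nat ler_pdivrMr// hP; lra.
rewrite normcM normcV normcX normc_nat => h.
apply: le_trans (_ : c * normc w <= _); first by rewrite -(natr1 k) -mulrA ler_pM2l//; lra.
apply: le_trans (_ : 2 ^+ n.+1 * (c * (normc w / 2 ^+ n.+1)) <= _).
  by rewrite (mulrA c) mulrCA divff ?mulr1// gt_eqF.
by rewrite ler_pM2l.
Qed.

Lemma notint_neq0 z : notint z ->
  (forall k, z + k%:R != 0) /\ (forall k, z - 1 - k%:R != 0).
Proof.
move=> nz; split=> k.
  by rewrite addr_eq0; apply/eqP => e; apply: (nz (- k%:Z)); rewrite intrN -pmulrn.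
rewrite -addrA -opprD subr_eq0; apply/eqP => e.
by apply: (nz (1 + k%:Z)); rewrite intrD -pmulrn.
Qed.

Lemma pcsc2_series z : notint z ->
  tends \oo (fun K => \sum_(k < K)
    (((z + k%:R) ^+ 2)^-1 + ((z - 1 - k%:R) ^+ 2)^-1)) (pcsc2 z).
Proof.
move=> nz; have [c [K0 [n0 [c0 hc]]]] := csinpi_scaled_ge z.
have [nz1 nz2] := notint_neq0 nz.
apply: (@tannery (fun n k => 4^-1 ^+ n.+1 *
    (pcsc2 ((z + k%:R) / 2 ^+ n.+1) + pcsc2 ((z - 1 - k%:R) / 2 ^+ n.+1)))
  (fun k => ((z + k%:R) ^+ 2)^-1 + ((z - 1 - k%:R) ^+ 2)^-1)
  _ (2 * (pi / c) ^+ 2) K0 n0).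
- by rewrite mulr_ge0// exprn_ge0// divr_ge0 ?pi_ge0// ltW.
- move=> n _; rewrite -mulr_sumr; apply: duplication_iter => //.
    exact: pcsc2_duplication.
  exact: pcsc2D1.
- move=> k; refine (eq_tends _
    (tendsD (tends_pcsc2_scaled (nz1 k)) (tends_pcsc2_scaled (nz2 k)))) => n.
  by rewrite mulrDr.
- move=> n k n0n kn; have [h1 h2] := hc n k n0n kn.
  have H w : c * k.+1%:R <= normc (2 ^+ n.+1 * csinpi w) ->
      normc (4^-1 ^+ n.+1 * pcsc2 w) <= (pi / c) ^+ 2 / k.+1%:R ^+ 2.
    move=> h; have -> : 4^-1 ^+ n.+1 * pcsc2 w = (pi%:C / (2 ^+ n.+1 * csinpi w)) ^+ 2.
      by rewrite /pcsc2 exprV4 -exprMn [in RHS]invfM [in RHS]mulrCA.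
    rewrite normcX normcM normcR normcV ger0_norm ?pi_ge0// -expr_div_n.
    have k0 : 0 < k.+1%:R :> R by rewrite ltr0n.
    rewrite ler_pXn2r ?nnegrE ?divr_ge0 ?normc_ge0 ?pi_ge0 ?(ltW c0) ?(ltW k0)//.
    rewrite -mulrA ler_wpM2l ?pi_ge0// -invfM lef_pV2 ?posrE ?mulr_gt0//.
    by rewrite (lt_le_trans _ h)// mulr_gt0.
  rewrite mulrDr (le_trans (ler_normcD _ _))// -[leRHS]mulrA mulr_natl mulr2n.
  by apply: lerD; apply: H.
Qed.

(** A single cotangent term decays only like [1 / k], so the pair must be estimated together: [cot v
    + cot w = sin(v + w) / (sin v sin w)]. Here [v + w = (2 z - 1) / 2^(n+1)] does not depend on
    [k]; the scaled numerator is bounded by [B], and the denominator supplies [k^2]. *)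
Lemma pcot_series z : notint z ->
  tends \oo (fun K => \sum_(k < K) ((z + k%:R)^-1 + (z - 1 - k%:R)^-1)) (pcot z).
Proof.
move=> nz; have [c [K0 [n0 [c0 hc]]]] := csinpi_scaled_ge z.
have [nz1 nz2] := notint_neq0 nz.
pose u := 2 * z - 1.
have [B [n1 [B0 hB]]] : exists B n1, 0 <= B :> R /\ forall n, (n1 <= n)%N ->
    normc (2 ^+ n * csinpi (u / 2 ^+ n)) <= B.
  have [|N hN] := (tendsc_ooP _ _).1 (@tends_csinpi_scaled R u) 1; first by [].
  exists (normc (pi%:C * u) + 1), N; split; first by rewrite addr_ge0 ?normc_ge0.
  move=> n /hN; have := ler_normc_sub (2 ^+ n * csinpi (u / 2 ^+ n)) (pi%:C * u); lra.
apply: (@tannery (fun n k => 2^-1 ^+ n.+1 *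
    (pcot ((z + k%:R) / 2 ^+ n.+1) + pcot ((z - 1 - k%:R) / 2 ^+ n.+1)))
  (fun k => (z + k%:R)^-1 + (z - 1 - k%:R)^-1)
  _ (pi * B / c ^+ 2) K0 (maxn n0 n1)).
- by rewrite divr_ge0 ?exprn_ge0 ?mulr_ge0 ?pi_ge0// ltW.
- move=> n _; rewrite -mulr_sumr; apply: duplication_iter => //.
    exact: pcot_duplication.
  exact: pcotD1.
- move=> k; refine (eq_tends _
    (tendsD (tends_pcot_scaled (nz1 k)) (tends_pcot_scaled (nz2 k)))) => n.
  by rewrite mulrDr.
- move=> n k; rewrite geq_max => /andP[n0n n1n] kn; have [h1 h2] := hc n k n0n kn.
  have k0 : 0 < k.+1%:R :> R by rewrite ltr0n.
  have P0 : 2 ^+ n.+1 != 0 :> C by rewrite expf_neq0.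
  have ck0 : 0 < c * k.+1%:R by rewrite mulr_gt0.
  have nu := hB n.+1 (leqW n1n).
  have uE : u / 2 ^+ n.+1 = (z + k%:R) / 2 ^+ n.+1 + (z - 1 - k%:R) / 2 ^+ n.+1.
    by rewrite -mulrDl /u; congr (_ / _); ring.
  move: h1 h2 nu; rewrite uE /pcot csinpiD.
  move: ((z + k%:R) / _) ((z - 1 - k%:R) / _) => v w.
  move: (csinpi v) (csinpi w) (ccospi v) (ccospi w) => sv sw cv cw h1 h2 nu.
  have sv0 : sv != 0.
    apply/eqP => e; move: h1; rewrite e mulr0 normc0; lra.
  have sw0 : sw != 0.
    apply/eqP => e; move: h2; rewrite e mulr0 normc0; lra.
  have -> : 2^-1 ^+ n.+1 * (pi%:C * cv / sv + pi%:C * cw / sw) =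
     pi%:C * (2 ^+ n.+1 * (sv * cw + cv * sw)) /
       ((2 ^+ n.+1 * sv) * (2 ^+ n.+1 * sw)).
    by rewrite exprVn; field; rewrite P0 sv0 sw0.
  move: (2 ^+ n.+1 * (_ + _)) (2 ^+ n.+1 * sv) (2 ^+ n.+1 * sw) nu h1 h2 => U V W.
  rewrite normcM normcV 2!normcM normcR ger0_norm ?pi_ge0//.
  move: (normc U) (normc V) (normc W) => X Y Z nu h1 h2.
  have YZ0 : 0 < Y * Z by rewrite mulr_gt0// (lt_le_trans ck0).
  have YZ : (c * k.+1%:R) ^+ 2 <= Y * Z by rewrite expr2 ler_pM// ltW.
  rewrite ler_pdivrMr//; apply: (@le_trans _ _ (pi * B)).
    by rewrite ler_wpM2l ?pi_ge0.
  rewrite [leLHS](_ : _ = pi * B / c ^+ 2 / k.+1%:R ^+ 2 * (c * k.+1%:R) ^+ 2).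
    rewrite ler_wpM2l// !divr_ge0 ?exprn_ge0 ?mulr_ge0 ?pi_ge0// ltW//.
  by field; rewrite !gt_eqF.
Qed.

End PartialFractions.

(** * The Eisenstein series of weight 2 *)

Section Basel.
Variable R : realType.
Local Notation C := R[i].

Lemma sum_ord_parity (V : zmodType) (f : nat -> V) n :
  \sum_(k < n + n) f k = \sum_(k < n) f (k + k)%N + \sum_(k < n) f (k + k).+1.
Proof.
elim: n => [|n IHn]; first by rewrite !big_ord0 addr0.
rewrite addSn addnS !big_ord_recr/= IHn -!addrA; congr (_ + _).
by rewrite !addrA; congr (_ + _); rewrite addrC.
Qed.

Lemma notint_half : notint (2^-1 : C).
Proof.
move=> m e; have : (2 * m)%:~R = 1%:~R :> C by rewrite intrM -e divff.
by move/intr_inj; lia.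
Qed.

Lemma cvg_sum_inv_sqr : exists a : R,
  tends \oo (fun K => \sum_(k < K) (k.+1%:R ^+ 2)^-1) a.
Proof.
set u := fun K => \sum_(k < K) (k.+1%:R ^+ 2)^-1.
suff h : cvgn u by exists (limn u).
apply: nondecreasing_is_cvgn.
  apply/nondecreasing_seqP => n; rewrite /u big_ord_recr/= lerDl invr_ge0.
  by rewrite exprn_ge0.
exists 2 => _ [n _ <-]; have := @sum_inv_sqr_le R 1 n ltr01 (lexx 1).
by rewrite divr1; apply: le_trans; apply: ler_sum => k _; rewrite addrC natr1.
Qed.

(** Convergence to some [a] is known beforehand; comparing two limits of one sequence then gives the
    linear equation [pi^2 = 8 (a - a / 4)]. *)
Lemma basel :
  tends \oo (fun K => \sum_(k < K) (k.+1%:R ^+ 2)^-1) ((pi ^+ 2 / 6)%:C : C).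
Proof.
have [a ha] := cvg_sum_inv_sqr.
pose A K : C := \sum_(k < K) (k.+1%:R ^+ 2)^-1.
have hA : tends \oo A a%:C.
  refine (eq_tends _ (tendsR ha)) => K; rewrite rmorph_sum; apply: eq_bigr => k _.
  by rewrite fmorphV rmorphXn rmorph_nat.
suff -> : (pi ^+ 2 / 6)%:C = a%:C by [].
(* With [A] the partial sums, [A (2 K) - A K / 4] sums the inverse odd squares,
   which the squared cosecant at [1 / 2] evaluates to [pi ^ 2 / 8]. *)
have h1 : tends \oo (fun K => 8 * (A (K + K)%N - 4^-1 * A K)) (8 * (a%:C - 4^-1 * a%:C)).
  apply: tendsZ; apply: tendsB; last exact: tendsZ.
  by apply: (@tends_comp_nat _ (fun K => (K + K)%N) A) => // n; apply: leq_addr.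
have h2 : tends \oo (fun K => 8 * (A (K + K)%N - 4^-1 * A K)) (pi%:C ^+ 2).
  have := pcsc2_series notint_half; rewrite /pcsc2 csinpi_half divr1.
  apply: eq_tends => K; rewrite /A (sum_ord_parity (fun k => (k.+1%:R ^+ 2)^-1 : C)) mulr_sumr.
  have -> : \sum_(k < K) (((k + k).+2%:R : C) ^+ 2)^-1 = \sum_(k < K) 4^-1 * (k.+1%:R ^+ 2)^-1.
    apply: eq_bigr => k _; rewrite -invfM; congr (_^-1).
    rewrite (_ : (k + k).+2 = k.+1 + k.+1)%N; last by lia.
    by rewrite natrD; ring.
  rewrite addrK mulr_sumr; apply: eq_bigr => k _.
  have n1 : (k + k).+1%:R != 0 :> C by rewrite pnatr_eq0.
  have -> : 2^-1 + k%:R = (k + k).+1%:R / 2 :> C.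
    by rewrite -(natr1 (k + k)%N) natrD; field.
  have -> : 2^-1 - 1 - k%:R = - ((k + k).+1%:R / 2) :> C.
    by rewrite -(natr1 (k + k)%N) natrD; field.
  by field.
have := tends_unique h2 h1.
rewrite rmorphM fmorphV rmorphXn rmorph_nat => ->.
by field.
Qed.

End Basel.

(** * Expansions in [q = exp(2 pi i z)] and geometric series *)

Section QExpansions.
Variable R : realType.
Local Notation C := R[i].
Implicit Types (z w tau : C) (n k : nat).

Definition qexp z : C := cexp ((2 * pi)%:C * 'i%C * z).

Lemma qexpE z : qexp z = cexp (ipi R * z) ^+ 2.
Proof.
rewrite -cexpM_nat /qexp; congr cexp.
by rewrite rmorphM rmorph_nat /ipi (mulrC 'i%C) !mulrA.
Qed.

Lemma qexpD z w : qexp (z + w) = qexp z * qexp w.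
Proof. by rewrite /qexp mulrDr cexpD. Qed.

Lemma qexpM_nat n z : qexp (n%:R * z) = qexp z ^+ n.
Proof. by rewrite /qexp mulrCA cexpM_nat. Qed.

Lemma normc_qexp z : normc (qexp z) = expR (- (2 * pi * complex.Im z)).
Proof.
by rewrite normc_cexp; congr expR; case: z => x y /=; ring.
Qed.

Lemma normc_qexp_lt1 z : 0 < complex.Im z -> normc (qexp z) < 1.
Proof.
move=> z0; rewrite normc_qexp expR_lt1 oppr_lt0 mulr_gt0// mulr_gt0//.
exact: pi_gt0.
Qed.

Lemma pcsc2_qexp z :
  pcsc2 z = - (4 * pi%:C ^+ 2) * (qexp z / (1 - qexp z) ^+ 2).
Proof.
rewrite /pcsc2 /csinpi cexpN qexpE; have := cexp_neq0 (ipi R * z).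
move: (cexp _) => A A0; have i0 := i_neq0 R; have i2 := sqr_i R.
have -> : (A - A^-1) / (2 * 'i%C) = (A ^+ 2 - 1) / (2 * 'i%C * A).
  by field; rewrite A0 i0.
rewrite invf_div !exprMn i2.
by rewrite -[in RHS](sqrrN (1 - _)) opprB -exprVn exprVn; ring.
Qed.

Lemma pcot_qexp z : notint z ->
  pcot z = pi%:C * 'i%C * ((qexp z + 1) / (qexp z - 1)).
Proof.
move=> /csinpi_neq0; rewrite /pcot /csinpi /ccospi cexpN qexpE.
have := cexp_neq0 (ipi R * z).
move: (cexp _) => A A0; have i0 := i_neq0 R.
have -> : (A - A^-1) / (2 * 'i%C) = (A ^+ 2 - 1) / (2 * 'i%C * A).
  by field; rewrite A0 i0.
rewrite mulf_eq0 negb_or => /andP[s0 _].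
by move: (pi%:C) => p; field; rewrite A0 i0 s0.
Qed.

Lemma tends_normc_geometric (y c : C) : normc y < 1 ->
  tends \oo (fun n => c * y ^+ n) 0.
Proof.
move=> y1; apply: (@tends_squeeze _ 0 _ (fun n => normc c * normc y ^+ n)).
  by move=> n _; rewrite subr0 normcM normcX.
by apply: tends_geometric; rewrite normc_ge0.
Qed.

Lemma tends_pcot_pinfty z tau : 0 < complex.Im tau ->
  (forall n, notint (z + n%:R * tau)) ->
  tends \oo (fun n => pcot (z + n%:R * tau)) (- (pi%:C * 'i%C)).
Proof.
move=> t0 nz; have hq := tends_normc_geometric (qexp z) (normc_qexp_lt1 t0).
have -> : - (pi%:C * 'i%C) = pi%:C * 'i%C * ((0 + 1) / (0 - 1)) :> C.
  by rewrite add0r sub0r invrN invr1 mulrN mulr1 mulrN mulr1.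
have h1 : 0 - 1 != 0 :> C by rewrite sub0r oppr_eq0 oner_eq0.
refine (eq_tends _ (tendsZ (pi%:C * 'i%C) (tendsM (tendsD hq (tends_cst 1))
  (tendsV h1 (tendsB hq (tends_cst 1)))))) => n.
by rewrite pcot_qexp// qexpD qexpM_nat.
Qed.

(** Each of the [n] terms of [1 + s + ... + s^(n-1)] is at least [s^n]. *)
Lemma natr_exp_le (s : R) n : 0 <= s <= 1 -> (1 - s) * (n%:R * s ^+ n) <= 1 - s ^+ n.
Proof.
move=> /andP[s0 s1]; elim: n => [|n IHn]; first by rewrite mul0r mulr0 subrr.
have h : 0 <= s ^+ n.+1 <= 1 by rewrite exprn_ge0//= exprn_ile1.
have -> : (1 - s) * (n.+1%:R * s ^+ n.+1) =
    s * ((1 - s) * (n%:R * s ^+ n)) + (1 - s) * s ^+ n.+1.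
  by rewrite -(natr1 n) exprS; ring.
have := ler_wpM2l s0 IHn; have -> : s * (1 - s ^+ n) = s - s ^+ n.+1.
  by rewrite exprS; ring.
nra.
Qed.

(** With [s = sqrt r], [n r^n = (n s^n) s^n <= s^n / (1 - s)]. *)
Lemma tends_natr_geometric (r : R) : 0 <= r < 1 ->
  tends \oo (fun n => n%:R * r ^+ n) 0.
Proof.
move=> /andP[r0 r1]; pose s := Num.sqrt r.
have s0 : 0 <= s := sqrtr_ge0 r.
have ss : s ^+ 2 = r by apply: sqr_sqrtr.
have s1 : s < 1 by rewrite -(@ltr_pXn2r _ 2) ?nnegrE// ss expr1n.
have hs : tends \oo (fun n => (1 - s)^-1 * s ^+ n) 0.
  by apply: tends_geometric; rewrite s0.
apply/tends_ooP => e /((tends_ooP _ _).1 hs)[N hN]; exists N => n /hN.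
rewrite !subr0; apply: le_lt_trans; rewrite -ss exprAC.
have sn0 : 0 <= s ^+ n by rewrite exprn_ge0.
rewrite !ger0_norm ?mulr_ge0 ?exprn_ge0// ?invr_ge0; [|lra..].
have s1' : 0 < 1 - s by lra.
rewrite expr2 mulrA ler_wpM2r// -[X in _ <= X]mulr1 ler_pdivlMl//.
have s01 : 0 <= s <= 1 by rewrite s0 ltW.
have := natr_exp_le n s01; lra.
Qed.

Lemma sum_natr_geometric (K : comRingType) (y : K) n :
  (1 - y) ^+ 2 * (\sum_(d < n) d.+1%:R * y ^+ d) =
  1 - n.+1%:R * y ^+ n + n%:R * y ^+ n.+1.
Proof.
elim: n => [|n IHn]; first by rewrite big_ord0 expr0; ring.
rewrite big_ord_recr/= mulrDr IHn -!(natr1 n.+1) -!(natr1 n) !exprS; ring.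
Qed.

Lemma tends_sum_natr_geometric (y : C) : normc y < 1 ->
  tends \oo (fun n => \sum_(d < n) d.+1%:R * y ^+ d.+1) (y / (1 - y) ^+ 2).
Proof.
move=> y1.
have ny : 1 - y != 0.
  by rewrite subr_eq0; apply/eqP => e; move: y1; rewrite -e normc1 ltxx.
have h0 : tends \oo (fun n => n%:R * y ^+ n) 0.
  apply: (@tends_squeeze _ 0 _ (fun n => n%:R * normc y ^+ n)).
    by move=> n _; rewrite subr0 normcM normcX normc_nat.
  by apply: tends_natr_geometric; rewrite normc_ge0.
have h1 := tends_normc_geometric 1 y1.
have -> : y / (1 - y) ^+ 2 = y / (1 - y) ^+ 2 * (1 - (0 + 0) + y * 0).
  by rewrite addr0 subr0 mulr0 addr0 mulr1.
refine (eq_tends _ (tendsZ (y / (1 - y) ^+ 2)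
  (tendsD (tendsB (tends_cst 1) (tendsD h0 h1)) (tendsZ y h0)))) => n.
have -> : \sum_(d < n) d.+1%:R * y ^+ d.+1 = y * \sum_(d < n) d.+1%:R * y ^+ d.
  by rewrite mulr_sumr; apply: eq_bigr => d _; rewrite exprS mulrCA.
rewrite -mulrA; congr (_ * _).
apply: (@mulfI _ ((1 - y) ^+ 2)); first by rewrite expf_neq0.
rewrite sum_natr_geometric mulVKf ?expf_neq0// -(natr1 n) exprS; ring.
Qed.

Lemma sum_natr_geometric_le (r : R) n : 0 <= r < 1 ->
  \sum_(d < n) d.+1%:R * r ^+ d <= ((1 - r) ^+ 2)^-1.
Proof.
move=> /andP[r0 r1]; have h := @sum_natr_geometric R r n.
have P0 : 0 < (1 - r) ^+ 2 by rewrite exprn_gt0//; lra.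
rewrite -[leRHS]mulr1 ler_pdivlMl// h.
have := mulr_ge0 (ler0n R n) (exprn_ge0 n r0); have := exprn_ge0 n r0.
rewrite -(natr1 n) exprS; nra.
Qed.

Lemma sum_geometric_le (r : R) n : 0 <= r < 1 ->
  \sum_(d < n) r ^+ d <= (1 - r)^-1.
Proof.
move=> /andP[r0 r1]; have P0 : 0 < 1 - r by lra.
rewrite -[leRHS]mulr1 ler_pdivlMl// -opprB mulNr -subrX1.
have := exprn_ge0 n r0; lra.
Qed.

End QExpansions.

Section G2Series.
Variable R : realType.
Local Notation C := R[i].
Implicit Types (tau : C).

(** Lambert series: both are sums of the family [d x^(a d)] over [a, d >= 1]. Fixing [a] gives
    [x^a / (1 - x^a)^2]; collecting [a d = n] gives [sigma1 n * x^n]. Absolute convergence makes the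
    two limits equal. *)
Lemma tends_sum_divisors (x : C) : normc x < 1 -> exists S : C,
  tends \oo (fun N => \sum_(a < N) x ^+ a.+1 / (1 - x ^+ a.+1) ^+ 2) S /\
  tends \oo (fun N => \sum_(1 <= n < N) (sigma1 n)%:R * x ^+ n) S.
Proof.
move=> x1; set r := normc x in x1; have r0 : 0 <= r := normc_ge0 x.
have r01 : 0 <= r < 1 by rewrite r0.
pose f (p : nat * nat) : C := p.2.+1%:R * x ^+ (p.1.+1 * p.2.+1).
pose box N D := [seq (a, d) | a <- index_iota 0 N, d <- index_iota 0 D].
have ubox N D : uniq (box N D).
  by apply: allpairs_uniq => [||[? ?] [? ?] _ _ []]; rewrite ?iota_uniq// => -> ->.
have inbox p N D : (p.1 < N)%N -> (p.2 < D)%N -> p \in box N D.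
  case: p => a d /= aN dD; apply/allpairsP; exists (a, d).
  by rewrite !mem_index_iota aN dD.
have [S hS] : exists S, tends (@summability.totally (nat * nat)%type)
    (summability.partial_sum f) S.
  (* Since [(a + 1) (d + 1) >= a + d], the family is dominated by a product of two one-variable
     series. *)
  apply: (@tends_psum_majorant _ _ f (fun p => r ^+ p.1 * (p.2.+1%:R * r ^+ p.2))
    ((1 - r)^-1 * ((1 - r) ^+ 2)^-1) fset0 (fun N => box N N)).
  - by move=> p; rewrite !mulr_ge0// exprn_ge0.
  - move=> [a d] _ /=; rewrite /f normcM normc_nat normcX -/r mulrCA ler_wpM2l//=.
    by rewrite -exprD ler_wiXn2l// ?(ltW x1)//; lia.
  - by move=> n; apply: ubox.
  - move=> [a d]; exists (maxn a d).+1 => n; rewrite gtn_max => /andP[an dn].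
    by apply: inbox.
  - move=> n; have -> : \sum_(p <- box n n) r ^+ p.1 * (p.2.+1%:R * r ^+ p.2) =
        (\sum_(a < n) r ^+ a) * (\sum_(d < n) d.+1%:R * r ^+ d).
      rewrite big_allpairs big_mkord mulr_suml; apply: eq_bigr => a _.
      by rewrite big_mkord mulr_sumr.
    rewrite ler_pM ?sum_geometric_le ?sum_natr_geometric_le//.
      by rewrite sumr_ge0// => a _; rewrite exprn_ge0.
    by rewrite sumr_ge0// => a _; rewrite mulr_ge0// exprn_ge0.
exists S; split.
  apply: (tends_psum_iterated (s := box) hS) => //.
    move=> [a d]; exists a.+1 => N aN; exists d.+1 => D dD; exact: inbox.
  move=> N; have h (a : 'I_N) : tends \oo (fun D => \sum_(d < D) f (nat_of_ord a, nat_of_ord d))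
      (x ^+ a.+1 / (1 - x ^+ a.+1) ^+ 2).
    refine (eq_tends _ (tends_sum_natr_geometric (y := x ^+ a.+1) _)).
      by move=> D; apply: eq_bigr => d _; rewrite /f/= exprM.
    by rewrite normcX exprn_ilt1.
  refine (eq_tends _ (tends_sum _ (fun a _ => h a))) => D.
  by rewrite big_allpairs big_mkord; apply: eq_bigr => a _; rewrite big_mkord.
(* The pairs under the hyperbola, grouped by their product; the predecessors appear because [f]
   counts from [0]. *)
pose hyp N := [seq ((n %/ d).-1, d.-1) | n <- index_iota 1 N, d <- divisors n].
have div_gt0 n d : (0 < n)%N -> d \in divisors n -> [/\ (0 < d)%N, (0 < n %/ d)%N & (n %/ d * d = n)%N].
  move=> n0; rewrite -dvdn_divisors// => dn.
  have d0 := dvdn_gt0 n0 dn; split => //; last exact: divnK.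
  by rewrite divn_gt0// dvdn_leq.
refine (eq_tends _ (tends_psum_exhaust (s := hyp) hS _ _)).
- move=> N; rewrite big_allpairs_dep; apply: eq_big_nat => n /andP[n0 _].
  rewrite /sigma1 natr_sum mulr_suml !big_seq; apply: eq_bigr => d /(div_gt0 _ _ n0)[d0 nd0 e].
  by rewrite /f/= !prednK// e.
- move=> N; apply: allpairs_uniq_dep; first exact: iota_uniq.
    by move=> n _; apply: divisors_uniq.
  move=> [n d] [n' d'] /allpairsPdep[m [e [hm he ->]]] /allpairsPdep[m' [e' [hm' he' ->]]] /=.
  move: hm hm'; rewrite !mem_index_iota => /andP[m0 _] /andP[m'0 _] [h1 h2].
  have [e0 me0 E] := div_gt0 _ _ m0 he; have [e'0 me'0 E'] := div_gt0 _ _ m'0 he'.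
  have {}h2 : e = e' by lia.
  have {}h1 : (m %/ e = m' %/ e')%N by lia.
  by move: E; rewrite h1 h2 E' => ->.
- move=> [a d]; exists (a.+1 * d.+1).+1 => N hN.
  apply/allpairsPdep; exists (a.+1 * d.+1)%N, d.+1; rewrite mem_index_iota hN.
  by rewrite -dvdn_divisors// dvdn_mull// mulnK.
Qed.

(** Each squared cosecant is [- 4 pi^2 q / (1 - q)^2], and the constants agree:
    [2 (- 4 pi^2) = (pi^2 / 3) (- 24)]. This is [G2] in the form in which row summation produces
    it. *)
Lemma tends_G2 tau : 0 < complex.Im tau ->
  tends \oo (fun N => (pi ^+ 2 / 3)%:C + 2 * \sum_(a < N) pcsc2 (a.+1%:R * tau))
    (G2 tau).
Proof.
move=> t0; have [S [h1 h2]] := tends_sum_divisors (normc_qexp_lt1 t0).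
have -> : G2 tau = (pi ^+ 2 / 3)%:C + 2 * (- (4 * pi%:C ^+ 2) * S).
  rewrite /G2 (tends_series (a := S)).
    have -> : (pi ^+ 2 / 3)%:C = pi%:C ^+ 2 / 3 :> C.
      by rewrite rmorphM fmorphV rmorphXn rmorph_nat.
    by move: (pi%:C) => p; field.
  refine (eq_tends _ h2) => N; apply: eq_bigr => n _.
  by rewrite -qexpM_nat /qexp !mulrA.
apply: tendsD; first exact: tends_cst.
apply: tendsZ; refine (eq_tends _ (tendsZ _ h1)) => N.
by rewrite mulr_sumr; apply: eq_bigr => a _; rewrite pcsc2_qexp qexpM_nat.
Qed.

End G2Series.

(** * The zeta series *)

Section LatticeSums.
Variable R : realType.
Local Notation C := R[i].
Implicit Types (tau z w : C) (p : int * int).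

Definition lattice_point tau p : C := p.1%:~R + p.2%:~R * tau.

Definition zeta_term z w : C := (z - w)^-1 + w^-1 + z / w ^+ 2.

Lemma Im_lattice_point tau p :
  complex.Im (lattice_point tau p) = p.2%:~R * complex.Im tau.
Proof.
case: tau p => a b [m n]; rewrite /lattice_point /=.
rewrite -!(rmorph_int (real_complex R)); rewrite /=; ring.
Qed.

(** The imaginary part controls [n], and then [m = w - n tau] is controlled by [|w|] and
    [|n| |tau|]; adding the two bounds gives the constant [K]. *)
Lemma lattice_point_norm_ge tau : 0 < complex.Im tau ->
  exists2 c : R, 0 < c &
    forall p, c * (`|p.1| + `|p.2|)%:R <= normc (lattice_point tau p).
Proof.
move=> t0; set t := complex.Im tau in t0.
pose K := 1 + (normc tau + 1) / t.
have K0 : 0 < K by rewrite addr_gt0// divr_gt0// ltr_wpDl ?normc_ge0.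
exists K^-1; first by rewrite invr_gt0.
move=> p; rewrite ler_pdivrMl// natrD.
have hn : `|p.2|%:R * t <= normc (lattice_point tau p).
  apply: le_trans (Im_le_normc _); rewrite Im_lattice_point normrM -/t.
  by rewrite (gtr0_norm t0) -intr_norm -abszE.
have hm : `|p.1|%:R <= normc (lattice_point tau p) + `|p.2|%:R * normc tau.
  have -> : `|p.1|%:R = normc (p.1%:~R : C) by rewrite normc_int -abszE.
  have -> : p.1%:~R = lattice_point tau p - p.2%:~R * tau by rewrite addrK.
  apply: le_trans (ler_normcD _ _) _.
  by rewrite normcN normcM normc_int -abszE.
have hn' : `|p.2|%:R <= normc (lattice_point tau p) / t by rewrite ler_pdivlMr.
have := ler_wpM2r (normc_ge0 tau) hn'.
have -> : K * normc (lattice_point tau p) = normc (lattice_point tau p) +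
   normc (lattice_point tau p) / t * normc tau + normc (lattice_point tau p) / t.
  by rewrite /K; field; rewrite gt_eqF.
lra.
Qed.

Lemma lattice_point_eq0 tau p : 0 < complex.Im tau ->
  lattice_point tau p = 0 -> p = (0, 0).
Proof.
move=> /lattice_point_norm_ge[c c0 hc] e; have := hc p.
rewrite e normc0 pmulr_rle0// lern0 addn_eq0 !absz_eq0.
by case: p {e} => m n /= /andP[/eqP-> /eqP->].
Qed.

Lemma lattice_point_inj tau : 0 < complex.Im tau -> injective (lattice_point tau).
Proof.
move=> t0 [m n] [m' n'] e; have : lattice_point tau (m - m', n - n') = 0.
  transitivity (lattice_point tau (m, n) - lattice_point tau (m', n')).
    by rewrite /lattice_point /= !intrB; ring.
  by rewrite e subrr.
by move/(lattice_point_eq0 t0) => [/eqP + /eqP]; rewrite !subr_eq0 => /eqP-> /eqP->.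
Qed.

(* The rows exhaust [-M < m <= M] rather than [-M <= m <= M], matching the
   range [z + k], [z - 1 - k] of the partial fraction expansions. *)
Definition rows M : seq int :=
  [seq - (k%:Z) | k <- index_iota 0 M] ++ [seq k.+1%:Z | k <- index_iota 0 M].

Definition cols N : seq int :=
  0 :: [seq a.+1%:Z | a <- index_iota 0 N] ++ [seq - a.+1%:Z | a <- index_iota 0 N].

Definition lattice_box N M := [seq (m, n) | n <- cols N, m <- rows M].

Lemma rows_uniq M : uniq (rows M).
Proof.
rewrite cat_uniq !map_inj_uniq ?iota_uniq; [|by move=> ? ? /eqP; lia..].
rewrite /= andbT; apply/hasPn => _ /mapP[k _ ->]; apply/mapP => -[j _]; lia.
Qed.

Lemma cols_uniq N : uniq (cols N).
Proof.
rewrite cons_uniq cat_uniq !map_inj_uniq ?iota_uniq; [|by move=> ? ? /eqP; lia..].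
rewrite mem_cat /= andbT; apply/andP; split.
  by apply/norP; split; apply/mapP => -[j _]; lia.
by apply/hasPn => _ /mapP[k _ ->]; apply/mapP => -[j _]; lia.
Qed.

Lemma lattice_box_uniq N M : uniq (lattice_box N M).
Proof.
apply: allpairs_uniq; [exact: cols_uniq|exact: rows_uniq|].
by move=> [? ?] [? ?] _ _ [-> ->].
Qed.

Lemma mem_lattice_box N M p : (`|p.1| < M)%N -> (`|p.2| <= N)%N ->
  p \in lattice_box N M.
Proof.
case: p => m n /= mM nN; apply/allpairsP; exists (n, m) => /=; split=> //.
  rewrite inE mem_cat; case: n nN => [[|a]|a] aN; apply/or3P; first by constructor 1.
    by constructor 2; apply/mapP; exists a; rewrite ?mem_index_iota//=; lia.
  by constructor 3; apply/mapP; exists a; rewrite ?mem_index_iota//=; lia.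
rewrite mem_cat; case: m mM => [[|k]|k] kM; apply/orP.
- by left; apply/mapP; exists 0%N; rewrite ?mem_index_iota//=; lia.
- by right; apply/mapP; exists k; rewrite ?mem_index_iota//=; lia.
- by left; apply/mapP; exists k.+1; rewrite ?mem_index_iota//=; lia.
Qed.

Lemma sum_rows (V : zmodType) (h : int -> V) M :
  \sum_(m <- rows M) h m = \sum_(k < M) (h (- k%:Z) + h k.+1%:Z).
Proof. by rewrite big_cat !big_map !big_mkord [RHS]big_split. Qed.

Lemma sum_cols (V : zmodType) (h : int -> V) N :
  \sum_(n <- cols N) h n = h 0 + \sum_(a < N) (h a.+1%:Z + h (- a.+1%:Z)).
Proof. by rewrite big_cons big_cat !big_map !big_mkord [in RHS]big_split. Qed.

Lemma sum_lattice_box (V : zmodType) (h : int * int -> V) N M :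
  \sum_(p <- lattice_box N M) h p = \sum_(n <- cols N) \sum_(m <- rows M) h (m, n).
Proof. by rewrite big_allpairs_dep. Qed.

(** One factor of the cube is traded for [1 / a] and the remaining square is summed over [m]. The
    result decays like [a^-2], so it can be summed once more over [n]. *)
Lemma sum_inv_cube_le (a : R) M : 1 <= a ->
  \sum_(m <- rows M) ((a + `|m|%:R) ^+ 3)^-1 <= 4 * (a ^+ 2)^-1.
Proof.
move=> a1; have a0 : 0 < a by lra.
rewrite sum_rows; apply: (@le_trans _ _ (\sum_(k < M) 2 / a * ((a + (k : nat)%:R) ^+ 2)^-1)).
  apply: ler_sum => k _; rewrite abszN !absz_nat.
  have k0 : 0 <= (k : nat)%:R :> R by [].
  have -> : (a + k.+1%:R) = (a + (k : nat)%:R) + 1 by rewrite -(natr1 k) addrA.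
  set b := a + _; have ab : a <= b by rewrite /b lerDl.
  have h1 : (b ^+ 3)^-1 <= a^-1 * (b ^+ 2)^-1.
    rewrite -invfM lef_pV2 ?posrE ?mulr_gt0 ?exprn_gt0; [|lra..].
    by rewrite (exprS b 2) ler_wpM2r ?exprn_ge0//; lra.
  have h2 : ((b + 1) ^+ 3)^-1 <= (b ^+ 3)^-1.
    by rewrite lef_pV2 ?posrE ?exprn_gt0; [rewrite ler_pXn2r ?nnegrE//; lra|by []|lra|by []|lra].
  lra.
rewrite -mulr_sumr; have := @sum_inv_sqr_le R a M a0 a1.
have h : 0 <= 2 / a by rewrite divr_ge0// ltW.
move=> /(ler_wpM2l h)/le_trans; apply.
by rewrite le_eqVlt; apply/orP; left; apply/eqP; field; rewrite gt_eqF.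
Qed.

(** The constant is [4] for [n = 0] plus [8 * 2] for all other [n]. *)
Lemma sum_lattice_box_le N M :
  \sum_(p <- lattice_box N M) ((1 + (`|p.1| + `|p.2|)%:R) ^+ 3)^-1 <= 20 :> R.
Proof.
rewrite sum_lattice_box.
apply: (@le_trans _ _ (\sum_(n <- cols N) 4 * ((1 + `|n|%:R) ^+ 2)^-1)).
  apply: ler_sum => n _; have /(sum_inv_cube_le M) : 1 <= 1 + `|n|%:R :> R by rewrite lerDl.
  apply: le_trans; apply: ler_sum => m _.
  by rewrite natrD (addrC `|m|%:R) addrA.
rewrite sum_cols absz0 addr0 expr1n invr1.
have := @sum_inv_sqr_le R 1 N ltr01 (lexx 1).
have : \sum_(a < N) (4 * ((1 + `|a.+1%:Z|%:R) ^+ 2)^-1 + 4 * ((1 + `|- a.+1%:Z|%:R) ^+ 2)^-1)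
   <= 8 * \sum_(k < N) ((1 + (k : nat)%:R) ^+ 2)^-1 :> R.
  rewrite mulr_sumr; apply: ler_sum => k _; rewrite abszN !absz_nat.
  have k0 : 0 <= (k : nat)%:R :> R by [].
  have : ((1 + k.+1%:R) ^+ 2)^-1 <= ((1 + (k : nat)%:R) ^+ 2)^-1 :> R.
    rewrite -(natr1 k) lef_pV2 ?posrE ?exprn_gt0//; [|lra..].
    by rewrite ler_pXn2r ?nnegrE//; lra.
  lra.
lra.
Qed.

Lemma zeta_termE z w : w != 0 -> z - w != 0 ->
  zeta_term z w = z ^+ 2 / (w ^+ 2 * (z - w)).
Proof. by move=> w0 zw0; rewrite /zeta_term; field; rewrite w0 zw0. Qed.

(** The convergence factors reduce the term to [z^2 / (w^2 (z - w))], and [|z - w| >= |w| / 2]. *)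
Lemma normc_zeta_term_le z w : w != 0 -> 2 * normc z <= normc w ->
  normc (zeta_term z w) <= 2 * normc z ^+ 2 / normc w ^+ 3.
Proof.
move=> w0 zw; have nw0 : 0 < normc w by rewrite normc_gt0.
have h := ler_normc_sub w z; rewrite normcB in h.
have nzw : 0 < normc (z - w) by lra.
rewrite zeta_termE// -?normc_gt0// normcM normcV [normc (_ * (z - w))]normcM !normcX.
rewrite ler_pdivrMr ?mulr_gt0 ?exprn_gt0//.
have -> : 2 * normc z ^+ 2 / normc w ^+ 3 * (normc w ^+ 2 * normc (z - w)) =
   normc z ^+ 2 * (2 * normc (z - w) / normc w) by field; rewrite gt_eqF.
rewrite ler_peMr ?exprn_ge0 ?normc_ge0// ler_pdivlMr//; lra.
Qed.

Definition zeta_summand tau z p : C :=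
  if p == (0, 0) then 0 else zeta_term z (lattice_point tau p).

Lemma tends_zeta_summand tau z : 0 < complex.Im tau -> exists S,
  tends (@summability.totally (int * int)%type)
    (summability.partial_sum (zeta_summand tau z)) S.
Proof.
move=> t0; have [c c0 hc] := lattice_point_norm_ge t0.
(* Outside the box of size [N] one has [|m| + |n| >= N], hence [|w| >= c N >= 2 |z|]. *)
pose N := (Num.truncn (2 * normc z / c)).+1.
have hN : 2 * normc z <= c * N%:R.
  by rewrite [leRHS]mulrC -ler_pdivrMr//; apply/ltW/truncnS_gt.
(* With [s = |m| + |n| >= 1], [|w| >= c s >= c (1 + s) / 2]; cubing costs [8], and the term estimate
   has a factor [2]. *)
pose M := 16 * normc z ^+ 2 / c ^+ 3.
have M0 : 0 <= M by rewrite divr_ge0 ?mulr_ge0 ?exprn_ge0 ?normc_ge0// ltW.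
apply: (@tends_psum_majorant _ _ _
  (fun p => M * ((1 + (`|p.1| + `|p.2|)%:R) ^+ 3)^-1) (M * 20)
  (seq_fset tt (lattice_box N N)) (fun n => lattice_box n n)).
- by move=> p; rewrite mulr_ge0// invr_ge0 exprn_ge0// addr_ge0.
- move=> p; rewrite seq_fsetE => pN; rewrite /zeta_summand; case: ifPn => [_|p0].
    by rewrite normc0 mulr_ge0// invr_ge0 exprn_ge0// addr_ge0.
  set s := (`|p.1| + `|p.2|)%N.
  have sN : (N <= s)%N.
    rewrite leqNgt; apply/negP => sN; move/negP: pN; apply.
    apply: mem_lattice_box; last apply: ltnW.
      by apply: leq_ltn_trans sN; apply: leq_addr.
    by apply: leq_ltn_trans sN; apply: leq_addl.
  have s1 : 1 <= s%:R :> R by rewrite ler1n (leq_trans _ sN).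
  have hs := hc p; rewrite -/s in hs.
  have w0 : 0 < normc (lattice_point tau p) by rewrite (lt_le_trans _ hs)// mulr_gt0//; lra.
  have zs : 2 * normc z <= normc (lattice_point tau p).
    apply: le_trans hN _; apply: le_trans hs; rewrite ler_pM2l// ler_nat//.
  apply: le_trans (normc_zeta_term_le _ zs) _; first by rewrite -normc_gt0.
  have cs : c * ((1 + s%:R) / 2) <= normc (lattice_point tau p).
    by apply: le_trans hs; rewrite ler_pM2l//; lra.
  have cs0 : 0 < c * ((1 + s%:R) / 2) by rewrite mulr_gt0//; lra.
  have -> : M * ((1 + s%:R) ^+ 3)^-1 = 2 * normc z ^+ 2 / (c * ((1 + s%:R) / 2)) ^+ 3.
    by rewrite /M; field; rewrite !gt_eqF//; lra.
  rewrite ler_wpM2l ?mulr_ge0 ?exprn_ge0 ?normc_ge0//.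
  by rewrite lef_pV2 ?posrE ?exprn_gt0// ler_pXn2r ?nnegrE ?(ltW cs0) ?(ltW w0).
- by move=> n; apply: lattice_box_uniq.
- move=> p; exists (`|p.1| + `|p.2|)%N.+1 => n hn.
  by apply: mem_lattice_box; [|apply: ltnW]; apply: leq_trans hn; rewrite ltnS ?leq_addr ?leq_addl.
- by move=> n; rewrite -mulr_sumr ler_wpM2l// sum_lattice_box_le.
Qed.

End LatticeSums.

(** * Row sums of the zeta series and its quasi-periods *)

Section ZetaSeries.
Variable R : realType.
Local Notation C := R[i].
Implicit Types (tau z w : C).

Lemma tends_harmonicC : tends \oo (fun n => (n%:R : C)^-1) 0.
Proof.
apply: (@tends_squeeze _ 1 _ (fun n => 2 / n.+1%:R)); last exact: tends_harmonic.
move=> n n0; rewrite subr0 normcV normc_nat.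
have n0' : 1 <= n%:R :> R by rewrite ler1n.
rewrite ler_pdivlMr ?ltr0n// -(natr1 n) mulrC ler_pdivrMr; lra.
Qed.

Lemma notint_lattice tau z n : 0 < complex.Im tau -> ~ lattice tau z ->
  notint (z + n%:~R * tau).
Proof.
move=> t0 nz m e; apply: nz; exists m, (- n).
by rewrite -e intrN mulNr addrK.
Qed.

Lemma notint_Mtau tau (n : int) : 0 < complex.Im tau -> n != 0 ->
  notint (n%:~R * tau).
Proof.
move=> t0 n0 m e; have : lattice_point tau (- m, n) = 0.
  by rewrite /lattice_point /= e intrN addNr.
by move/(lattice_point_eq0 t0) => [_ /eqP]; rewrite (negPf n0).
Qed.

(** In a row off the real axis, pairing [m = - k] with [m = k + 1] makes the three parts of the term
    converge separately, as expansions at [u], [v] and [v]. *)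
Lemma tends_row_nonzero tau z (n : int) : 0 < complex.Im tau ->
  ~ lattice tau z -> n != 0 ->
  tends \oo (fun M => \sum_(m <- rows M) zeta_summand tau z (m, n))
    (pcot (z - n%:~R * tau) - pcot (- (n%:~R * tau)) + z * pcsc2 (n%:~R * tau)).
Proof.
move=> t0 nz n0; set u := z - n%:~R * tau; set v := - (n%:~R * tau).
have nu : notint u.
  by rewrite /u -mulNr -intrN; apply: notint_lattice.
have nv : notint v by rewrite /v -mulNr -intrN; apply: notint_Mtau; rewrite ?oppr_eq0.
rewrite -pcsc2N -/v.
refine (eq_tends _ (tendsD (tendsB (pcot_series nu) (pcot_series nv))
  (tendsZ z (pcsc2_series nv)))) => M.
rewrite sum_rows mulr_sumr -sumrB -big_split; apply: eq_bigr => k _.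
have n0' a : ((a, n) == (0, 0)) = false by rewrite xpair_eqE (negPf n0) andbF.
rewrite /zeta_summand !n0' /zeta_term /lattice_point/=.
have -> : (- k%:Z)%:~R + n%:~R * tau = - (v + k%:R).
  by rewrite intrN -pmulrn /v; ring.
have -> : k.+1%:Z%:~R + n%:~R * tau = - (v - 1 - k%:R).
  by rewrite -pmulrn -(natr1 k) /v; ring.
have -> : z - - (v + k%:R) = u + k%:R by rewrite /u /v; ring.
have -> : z - - (v - 1 - k%:R) = u - 1 - k%:R by rewrite /u /v; ring.
rewrite !invrN !sqrrN.
by ring.
Qed.

Lemma tends_row_zero tau z : 0 < complex.Im tau -> ~ lattice tau z ->
  tends \oo (fun M => \sum_(m <- rows M) zeta_summand tau z (m, 0))
    (pcot z - z^-1 + z * (pi ^+ 2 / 3)%:C).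
Proof.
move=> t0 nz; have nu : notint z.
  by rewrite -[z]addr0 -(mul0r tau); apply: (notint_lattice (n := 0)).
have hb : tends \oo (fun M => \sum_(k < M) ((k%:R ^+ 2)^-1 + (k.+1%:R ^+ 2)^-1)) ((pi ^+ 2 / 3)%:C : C).
  have -> : (pi ^+ 2 / 3)%:C = 2 * (pi ^+ 2 / 6)%:C - 0 ^+ 2 :> C.
    by rewrite expr0n subr0 -[2](rmorph_nat (real_complex R)) -rmorphM; congr (_%:C); field.
  refine (eq_tends _ (tendsB (tendsZ 2 (@basel R)) (tendsX 2 tends_harmonicC))) => M.
  rewrite big_split/= mulr_natl mulr2n addrAC; congr (_ + _).
  elim: M => [|M IHM]; first by rewrite !big_ord0 invr0 expr0n subr0.
  rewrite !big_ord_recr/= -IHM !exprVn.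
  by move: (_^-1) => A; ring.
(* The summand [M^-1] is the sum of [1 / m] over the asymmetric range [- M < m <= M], [m != 0]:
   everything cancels but [m = M]. *)
have h : tends \oo (fun M => (\sum_(k < M) ((z + k%:R)^-1 + (z - 1 - k%:R)^-1)
    - z^-1 + M%:R^-1) + z * \sum_(k < M) ((k%:R ^+ 2)^-1 + (k.+1%:R ^+ 2)^-1))
  (pcot z - z^-1 + 0 + z * (pi ^+ 2 / 3)%:C).
  apply: tendsD; last exact: tendsZ.
  apply: tendsD; last exact: tends_harmonicC.
  by apply: tendsB (pcot_series nu) (tends_cst _).
rewrite -[X in X + _]addr0; apply: (@eventually_eq_tends _ 1 _ _ _ _ h) => M M0.
rewrite sum_rows.
(* Since [1 / 0 = 0], the excluded index [0] only removes [z^-1]. *)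
transitivity (\sum_(k < M) (((z + k%:R)^-1 + (z - 1 - k%:R)^-1)
   - (if (k : nat) == 0%N then z^-1 else 0)
   + (k.+1%:R^-1 - k%:R^-1) + z * ((k%:R ^+ 2)^-1 + (k.+1%:R ^+ 2)^-1))); last first.
  apply: eq_bigr => k _; rewrite /zeta_summand /zeta_term /lattice_point/= mul0r !addr0.
  rewrite intrN -!pmulrn !xpair_eqE eqxx andbT oppr_eq0 !eqz_nat.
  case: ifPn => [/eqP ->|k0].
    rewrite !(mulr0n, mulr1n, oppr0, subr0, addr0, add0r, invr0, invr1, expr0n, expr1n)/=.
    by ring.
  have -> : z - k.+1%:R = z - 1 - k%:R by rewrite -(natr1 k); ring.
  by rewrite subr0 opprK invrN sqrrN; ring.
rewrite !big_split/= -mulr_sumr; congr (_ + _ + _); last first.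
- by rewrite big_split.
- elim: M {M0} => [|M IHM]; first by rewrite !big_ord0 invr0 addr0.
  by rewrite !big_ord_recr/= addrACA -IHM; ring.
- congr (_ + _); case: M M0 => // M _; rewrite big_ord_recl/= big1 ?addr0// => k _.
  by rewrite oppr0.
Qed.

(** The common value [S] lets the sum over points of [C] in the definition of [zeta] be evaluated on
    pairs of integers. *)
Lemma tends_zeta_partial_sums tau z : 0 < complex.Im tau -> exists S : C,
  tends (@summability.totally C) (summability.partial_sum
    (fun w => if w \in lattice tau `\ 0 then zeta_term z w else 0)) S /\
  tends (@summability.totally (int * int)%type)
    (summability.partial_sum (zeta_summand tau z)) S.
Proof.
move=> t0; have [S hS] := tends_zeta_summand z t0; exists S; split=> //.
apply: (tends_psum_inj (phi := lattice_point tau)).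
- exact: lattice_point_inj.
- move=> w nw; case: ifPn => // /set_mem[[m [n wE]] _].
  by have := nw (m, n).
refine (eq_tends _ hS) => A; rewrite !psumE; apply: eq_bigr => p _ /=.
rewrite /zeta_summand; case: ifPn => [/eqP->|p0].
  rewrite ifF//; apply/negP => /set_mem[_]; apply.
  by rewrite /lattice_point mul0r addr0.
rewrite ifT//; apply/mem_set; split; first by exists p.1, p.2.
by move=> /(lattice_point_eq0 t0)/eqP; rewrite (negPf p0).
Qed.

Lemma zetaE tau z S :
  tends (@summability.totally C) (summability.partial_sum
    (fun w => if w \in lattice tau `\ 0 then zeta_term z w else 0)) S ->
  zeta tau z = z^-1 + S.
Proof. by move=> hS; congr (_ + _); apply: (tends_summability_sum hS). Qed.

Definition pcot_sum tau z N : C :=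
  pcot z + \sum_(a < N) (pcot (z - a.+1%:R * tau) + pcot (z + a.+1%:R * tau)).

(** Rows [n] and [- n] are added: the cotangents at [n tau] and [- n tau] cancel by oddness, and the
    squared cosecants form [z] times the partial sum in [tends_G2]. The row [0] cancels [z^-1]. The
    comparison is thus exact for each [N]. *)
Lemma zeta_series tau z : 0 < complex.Im tau -> ~ lattice tau z ->
  tends \oo (pcot_sum tau z) (zeta tau z - z * G2 tau).
Proof.
move=> t0 nz; have [S [h1 h2]] := tends_zeta_partial_sums z t0.
rewrite (zetaE h1).
pose row (n : int) : C := if n == 0 then pcot z - z^-1 + z * (pi ^+ 2 / 3)%:C
  else pcot (z - n%:~R * tau) - pcot (- (n%:~R * tau)) + z * pcsc2 (n%:~R * tau).
have hrow n : tends \oo (fun M => \sum_(m <- rows M) zeta_summand tau z (m, n)) (row n).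
  rewrite /row; case: ifPn => [/eqP->|n0]; first exact: tends_row_zero.
  exact: tends_row_nonzero.
have hS : tends \oo (fun N => \sum_(n <- cols N) row n) S.
  apply: (tends_psum_iterated (s := lattice_box) h2).
  - by move=> N M; apply: lattice_box_uniq.
  - move=> p; exists `|p.2|%N => N hN; exists `|p.1|%N.+1 => M hM.
    exact: mem_lattice_box.
  - move=> N; refine (eq_tends _ (tends_sum (cols N) (fun n _ => hrow n))) => M.
    by rewrite sum_lattice_box.
refine (eq_tends _ (tendsB (tendsD (tends_cst z^-1) hS) (tendsZ z (tends_G2 t0)))) => N.
rewrite sum_cols [row 0]/row eqxx /pcot_sum.
have -> : \sum_(a < N) (row a.+1%:Z + row (- a.+1%:Z)) =
  \sum_(a < N) (pcot (z - a.+1%:R * tau) + pcot (z + a.+1%:R * tau)) +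
  z * (2 * \sum_(a < N) pcsc2 (a.+1%:R * tau)).
  rewrite !mulr_sumr -big_split; apply: eq_bigr => a _; rewrite /row /=.
  rewrite intrN -!pmulrn mulNr !opprK pcotN pcsc2N; ring.
by ring.
Qed.

Lemma pcot_sumD1 tau z N : pcot_sum tau (z + 1) N = pcot_sum tau z N.
Proof.
rewrite /pcot_sum pcotD1; congr (_ + _); apply: eq_bigr => a _.
by rewrite addrAC pcotD1 addrAC pcotD1.
Qed.

(** The index range [[-N, N]] moves to [[-N + 1, N + 1]], so one term enters and one leaves. *)
Lemma pcot_sumDtau tau z N : pcot_sum tau (z + tau) N =
  pcot_sum tau z N + pcot (z + N.+1%:R * tau) - pcot (z - N%:R * tau).
Proof.
rewrite /pcot_sum; elim: N => [|N IHN].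
  by rewrite !big_ord0 !addr0 mul1r mul0r subr0; ring.
have e1 : z + tau - N.+1%:R * tau = z - N%:R * tau by rewrite -(natr1 N); ring.
have e2 : z + tau + N.+1%:R * tau = z + N.+2%:R * tau.
  by rewrite -(natr1 N.+1) -(natr1 N); ring.
rewrite !big_ord_recr/= addrA IHN e1 e2; ring.
Qed.

Lemma latticeD tau w (m n : int) :
  lattice tau (w + m%:~R + n%:~R * tau) <-> lattice tau w.
Proof.
split=> -[a [b e]].
  exists (a - m), (b - n); rewrite !intrB; move: e.
  move=> /(congr1 (fun x => x - m%:~R - n%:~R * tau)).
  rewrite (_ : w + _ + _ - _ - _ = w); [move=> ->; ring|ring].
by exists (a + m), (b + n); rewrite !intrD e; ring.
Qed.

Lemma zetaD1 tau z : 0 < complex.Im tau -> ~ lattice tau z ->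
  zeta tau (z + 1) = zeta tau z + G2 tau.
Proof.
move=> t0 nz.
have nz1 : ~ lattice tau (z + 1).
  by have := latticeD tau z 1 0; rewrite mul0r addr0 => h /h.
have h := eq_tends (pcot_sumD1 tau z) (zeta_series t0 nz1).
have /eqP : zeta tau (z + 1) - (z + 1) * G2 tau = zeta tau z - z * G2 tau.
  exact: tends_unique h (zeta_series t0 nz).
rewrite subr_eq => /eqP ->; ring.
Qed.

Lemma zetaDtau tau z : 0 < complex.Im tau -> ~ lattice tau z ->
  zeta tau (z + tau) = zeta tau z + tau * G2 tau - 2 * (pi%:C * 'i%C).
Proof.
move=> t0 nz.
have nz1 : ~ lattice tau (z + tau).
  by have := latticeD tau z 0 1; rewrite mul1r addr0 => h /h.
have h1 : tends \oo (fun N => pcot (z + N.+1%:R * tau)) (- (pi%:C * 'i%C)).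
  apply: (@tends_comp_nat _ S (fun N => pcot (z + N%:R * tau))) => //.
  apply: tends_pcot_pinfty => // n; rewrite pmulrn; exact: notint_lattice.
have h2 : tends \oo (fun N => pcot (z - N%:R * tau)) (pi%:C * 'i%C).
  rewrite -[X in tends _ _ X]opprK.
  have h : tends \oo (fun N => pcot (- z + N%:R * tau)) (- (pi%:C * 'i%C)).
    apply: tends_pcot_pinfty => // n m e.
    apply: (@notint_lattice tau z (- n%:Z) t0 nz (- m)).
    by rewrite !intrN -e -pmulrn; ring.
  by refine (eq_tends _ (tendsN h)) => N; rewrite -pcotN opprD opprK.
have h := eq_tends (pcot_sumDtau tau z) (zeta_series t0 nz1).
have /eqP : zeta tau (z + tau) - (z + tau) * G2 tau =
    zeta tau z - z * G2 tau + - (pi%:C * 'i%C) - pi%:C * 'i%C.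
  exact: tends_unique h (tendsB (tendsD (zeta_series t0 nz) h1) h2).
rewrite subr_eq => /eqP ->; ring.
Qed.

End ZetaSeries.

(** * Periodicity and modularity *)

Section Modularity.
Variable R : realType.
Local Notation C := R[i].
Implicit Types (tau z w : C) (g : 'M[int]_2).

Lemma conjc_int (m : int) : conjc (m%:~R : C) = m%:~R.
Proof. exact: rmorph_int. Qed.

Lemma conjcD z w : conjc (z + w) = conjc z + conjc w.
Proof. exact: rmorphD. Qed.

Lemma conjcM z w : conjc (z * w) = conjc z * conjc w.
Proof. exact: rmorphM. Qed.

Lemma zetastarD1 tau z : 0 < complex.Im tau -> ~ lattice tau z ->
  zetastar tau (z + 1) = zetastar tau z.
Proof.
move=> t0 nz; rewrite /zetastar zetaD1// /G2star.
have -> : (pi / complex.Im tau)%:C = pi%:C / (complex.Im tau)%:C.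
  by rewrite rmorphM fmorphV.
rewrite conjcD conjc1; move: (conjc z) (pi%:C) (_^-1) => *; ring.
Qed.

Lemma zetastarDtau tau z : 0 < complex.Im tau -> ~ lattice tau z ->
  zetastar tau (z + tau) = zetastar tau z.
Proof.
move=> t0 nz; rewrite /zetastar zetaDtau// /G2star.
have -> : (pi / complex.Im tau)%:C = pi%:C / (complex.Im tau)%:C.
  by rewrite rmorphM fmorphV.
have tt0 : (complex.Im tau)%:C != 0.
  by rewrite eq_complex/= gt_eqF.
(* The part [- 2 i Im tau] absorbs the [- 2 pi i] of [zetaDtau]; the part [tau] absorbs the
   correction [pi / Im tau] in [G2star]. *)
have -> : conjc (z + tau) = conjc z + (tau - 2 * (complex.Im tau)%:C * 'i%C).
  by rewrite conjcD -subcJ; ring.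
by move: (conjc z) (pi%:C) ((complex.Im tau)%:C) tt0 => a p t tt0; field.
Qed.

Lemma zetastar_periodic tau z (m n : int) : 0 < complex.Im tau ->
  ~ lattice tau z -> zetastar tau (z + m%:~R + n%:~R * tau) = zetastar tau z.
Proof.
move=> t0.
(* A negative multiple is handled by starting from the shifted point [y] and moving forward to [x],
   once [y] is known to avoid the lattice. *)
have iter (w : C) : (forall z, lattice tau (z + w) <-> lattice tau z) ->
    (forall z, ~ lattice tau z -> zetastar tau (z + w) = zetastar tau z) ->
    forall (m : int) z, ~ lattice tau z -> zetastar tau (z + m%:~R * w) = zetastar tau z.
  move=> lw hw; have pos (k : nat) x : ~ lattice tau x ->
      ~ lattice tau (x + k%:R * w) /\ zetastar tau (x + k%:R * w) = zetastar tau x.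
    move=> nx; elim: k => [|k [IH1 IH2]]; first by rewrite mul0r addr0.
    rewrite -(natr1 k) mulrDl mul1r addrA; split; first by move/lw.
    by rewrite hw.
  case=> k x nx; first by case: (pos k x nx).
  rewrite NegzE intrN mulNr; set y := x - _.
  have ny : ~ lattice tau y.
    move=> ly; apply: nx; rewrite -[x](subrK (k.+1%:~R * w)) -/y.
    elim: (k.+1) => [|i IHi]; first by rewrite mul0r addr0.
    by rewrite -pmulrn -(natr1 i) mulrDl mul1r addrA lw pmulrn.
  by have [_ <-] := pos k.+1 y ny; rewrite /y subrK.
have h1 : forall z, lattice tau (z + 1) <-> lattice tau z.
  by move=> x; have := latticeD tau x 1 0; rewrite mul0r addr0.
have h2 : forall z, lattice tau (z + tau) <-> lattice tau z.
  by move=> x; have := latticeD tau x 0 1; rewrite mul1r addr0.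
move=> nz; rewrite (iter tau)//; last first.
- by have := latticeD tau z m 0; rewrite mul0r addr0 => h /h.
- by move=> x nx; apply: zetastarDtau.
rewrite -[m%:~R]mulr1 (iter 1)// => x nx; exact: zetastarD1.
Qed.

Lemma det_int2 g : \det g = 1 -> g 0 0 * g 1 1 - g 0 1 * g 1 0 = 1.
Proof.
have l01 : lift (0 : 'I_2) (0 : 'I_1) = 1 by apply/val_inj.
have l10 : lift (1 : 'I_2) (0 : 'I_1) = 0 by apply/val_inj.
rewrite (expand_det_row _ 0) big_ord_recl big_ord1 /cofactor !det_mx11 !mxE.
rewrite l01 l10 expr0 expr1 mul1r mulN1r mulrN => <-.
by rewrite (_ : ord0 = 0)//; apply/val_inj.
Qed.

Lemma det_intr2 g : \det g = 1 ->
  (g 0 0)%:~R * (g 1 1)%:~R - (g 0 1)%:~R * (g 1 0)%:~R = 1 :> C.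
Proof. by move=> hg; rewrite -!intrM -intrB det_int2. Qed.

Lemma automorphy_neq0 g tau : \det g = 1 -> 0 < complex.Im tau ->
  automorphy g tau != 0.
Proof.
move=> /det_int2 hg t0; apply/eqP => e.
have : lattice_point tau (g 1 1, g 1 0) = 0 by rewrite -e /automorphy addrC.
by move/(lattice_point_eq0 t0) => [d0 c0]; move: hg; rewrite d0 c0 !mulr0 subrr.
Qed.

Lemma Im_mobius g tau : \det g = 1 -> 0 < complex.Im tau ->
  (complex.Im (mobius g tau))%:C =
  (complex.Im tau)%:C / (automorphy g tau * conjc (automorphy g tau)).
Proof.
move=> hg t0; have j0 := automorphy_neq0 hg t0.
have jc0 : conjc (automorphy g tau) != 0 by rewrite conjc_eq0.
have i0 := i_neq0 R; have hg' := det_intr2 hg.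
have h20 : 2 * 'i%C != 0 :> C by rewrite mulf_neq0.
(* Multiplication by [2 i] turns imaginary parts into [w - conj w]; what remains is a rational
   identity in which [tau] and its conjugate are independent. *)
apply: (mulfI h20).
have -> : 2 * 'i%C * (complex.Im (mobius g tau))%:C = mobius g tau - conjc (mobius g tau).
  by rewrite subcJ mulrAC.
have -> : 2 * 'i%C * ((complex.Im tau)%:C / (automorphy g tau * conjc (automorphy g tau))) =
   (tau - conjc tau) / (automorphy g tau * conjc (automorphy g tau)).
  by rewrite subcJ; ring.
rewrite /mobius conjcM conjc_inv conjcD conjcM !conjc_int.
move: j0 jc0; rewrite /automorphy conjcD conjcM !conjc_int.
move: (conjc tau) hg' => t' hg' j0 jc0.
have -> : tau - t' = ((g 0 0)%:~R * (g 1 1)%:~R - (g 0 1)%:~R * (g 1 0)%:~R) * (tau - t').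
  by rewrite hg' mul1r.
by field; rewrite j0 jc0.
Qed.

Lemma Im_mobius_gt0 g tau : \det g = 1 -> 0 < complex.Im tau ->
  0 < complex.Im (mobius g tau).
Proof.
move=> hg t0; rewrite -ltcR Im_mobius// -sqr_normc.
by rewrite divr_gt0 ?ltcR// exprn_gt0// normr_gt0 automorphy_neq0.
Qed.

(** Multiplied by [c tau + d], the generators [1] and [mobius g tau] become [c tau + d] and
    [a tau + b], another basis of the lattice of [tau]. The converse uses the coordinates given by
    the inverse matrix, integral as the determinant is [1]. *)
Lemma lattice_mobius g tau w : \det g = 1 -> 0 < complex.Im tau ->
  lattice (mobius g tau) ((automorphy g tau)^-1 * w) <-> lattice tau w.
Proof.
move=> hg t0; have j0 := automorphy_neq0 hg t0.
have hg' := det_intr2 hg.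
split=> -[m [n e]].
  exists (m * g 1 1 + n * g 0 1), (m * g 1 0 + n * g 0 0).
  rewrite -[w](mulVKf j0) e /mobius !intrD !intrM mulrDr.
  rewrite mulrCA [automorphy _ _ * (_ / _)]mulrC divfK// /automorphy; ring.
exists (m * g 0 0 - n * g 0 1), (n * g 1 1 - m * g 1 0).
apply: (mulfI j0); rewrite mulVKf// e /mobius !intrB !intrM mulrDr.
rewrite [automorphy _ _ * (_ * (_ / _))]mulrCA [automorphy _ _ * (_ / _)]mulrC divfK//.
rewrite -[LHS]mul1r -{1}hg' /automorphy; ring.
Qed.

(** Scaling by [j^-1] is a bijection between the two lattices and multiplies each term by [j]; the
    sum, being unordered, does not notice the change of basis. *)
Lemma zeta_mobius g tau z : \det g = 1 -> 0 < complex.Im tau ->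
  zeta (mobius g tau) ((automorphy g tau)^-1 * z) = automorphy g tau * zeta tau z.
Proof.
move=> hg t0; have j0 := automorphy_neq0 hg t0.
have lat := lattice_mobius _ hg t0.
move: (automorphy g tau) j0 lat => j j0 lat.
have [S [hS _]] := tends_zeta_partial_sums z t0.
have hS' : tends (@summability.totally C) (summability.partial_sum
    (fun w => if w \in lattice (mobius g tau) `\ 0
              then zeta_term (j^-1 * z) w else 0)) (j * S).
  apply: (tends_psum_inj (phi := fun w => j^-1 * w)).
  - by apply: mulfI; rewrite invr_eq0.
  - by move=> w /(_ (j * w)); rewrite mulKf.
  have FC := @summability.totally_filter C.
  refine (eq_tends _ (tendsZ j hS)) => A; rewrite !psumE mulr_sumr.
  apply: eq_bigr => w _ /=.
  have -> : (j^-1 * w \in lattice (mobius g tau) `\ 0) = (w \in lattice tau `\ 0).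
    apply/idP/idP => /set_mem[lw w0]; apply/mem_set; split.
    - exact/lat.
    - by move=> w0'; apply: w0; rewrite w0' /= mulr0.
    - exact/lat.
    - by move=> /eqP; rewrite mulf_eq0 invr_eq0 (negPf j0) => /eqP.
  case: ifPn => _; last by rewrite mulr0.
  have e1 : ((j^-1 * w) ^+ 2)^-1 = j ^+ 2 * (w ^+ 2)^-1.
    by rewrite exprMn [LHS]invfM -exprVn invrK.
  have e2 : (j^-1 * (z - w))^-1 = j * (z - w)^-1 by rewrite invfM invrK.
  have e3 : (j^-1 * w)^-1 = j * w^-1 by rewrite invfM invrK.
  rewrite /zeta_term -(mulrBr j^-1) e1 e2 e3.
  by move: ((z - w)^-1) (w^-1) ((w ^+ 2)^-1) => A' B' D'; field.
rewrite (zetaE hS') (zetaE hS) invfM invrK; ring.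
Qed.

(** Periodicity of [zetastar] read backwards, as a formula for the quasi-periods of [zeta] that
    mentions no basis of the lattice. *)
Lemma zetastar_shift tau z w : 0 < complex.Im tau -> ~ lattice tau z ->
  lattice tau w -> zeta tau (z + w) - zeta tau z =
    w * G2star tau + pi%:C * conjc w / (complex.Im tau)%:C.
Proof.
move=> t0 nz [m [n wE]]; have := zetastar_periodic m n t0 nz.
rewrite -addrA -wE /zetastar conjcD.
move: (zeta tau (z + w)) (zeta tau z) (G2star tau) (conjc z) (conjc w) pi%:C.
move: (_^-1) => t A B G z' w' p e.
have -> : A = A - (z + w) * G - p * (z' + w') * t + (z + w) * G + p * (z' + w') * t.
  by ring.
rewrite e; ring.
Qed.

(** The quasi-period at [1] for [tau] corresponds to the one at [j^-1] for [mobius g tau]. By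
    homogeneity the second is [j] times the first; the conjugate terms agree by [Im_mobius], which
    leaves [j^-1 G' = j G]. The point [z] is where the differences of [zeta] are taken. *)
Lemma G2star_mobius g tau z : \det g = 1 -> 0 < complex.Im tau ->
  ~ lattice tau z -> G2star (mobius g tau) = automorphy g tau ^+ 2 * G2star tau.
Proof.
move=> hg t0 nz; have j0 := automorphy_neq0 hg t0.
have t0' := Im_mobius_gt0 hg t0.
have lat1 : lattice tau 1 by exists 1, 0; rewrite mul0r addr0.
have h := zetastar_shift t0 nz lat1.
have h' := @zetastar_shift (mobius g tau) ((automorphy g tau)^-1 * z)
  ((automorphy g tau)^-1 * 1) t0'.
rewrite !lattice_mobius// -mulrDr !zeta_mobius// Im_mobius// in h'.
have {}h' := h' nz lat1.
have jc0 : conjc (automorphy g tau) != 0 by rewrite conjc_eq0.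
have tt0 : (complex.Im tau)%:C != 0 by rewrite eq_complex/= gt_eqF.
rewrite -mulrBr h mulr1 conjc1 mulr1 conjc_inv in h'.
move: h' tt0; move: (automorphy _ _) (conjc _) (G2star _) (G2star _) j0 jc0.
move: pi%:C ((complex.Im tau)%:C) => p t j j' G' G j0 j'0 e tt0.
have e2 : p / j' / (t / (j * j')) = j * (p / t) by field; rewrite j0 j'0 tt0.
move: e; rewrite e2 mul1r mulrDr => /addIr e.
by rewrite -[G'](mulVKf j0) -e expr2 mulrA.
Qed.

Lemma zetastar_mobius g tau z : \det g = 1 -> 0 < complex.Im tau ->
  ~ lattice tau z ->
  zetastar (mobius g tau) ((automorphy g tau)^-1 * z) =
    automorphy g tau * zetastar tau z.
Proof.
move=> hg t0 nz; have j0 := automorphy_neq0 hg t0.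
have jc0 : conjc (automorphy g tau) != 0 by rewrite conjc_eq0.
have tt0 : (complex.Im tau)%:C != 0 by rewrite eq_complex/= gt_eqF.
rewrite /zetastar zeta_mobius// (G2star_mobius hg t0 nz) Im_mobius//.
rewrite conjcM conjc_inv.
move: (automorphy _ _) (conjc (automorphy _ _)) j0 jc0 => j j' j0 j'0.
move: (zeta _ _) (G2star _) (conjc z) pi%:C ((complex.Im tau)%:C) tt0.
by move=> A G z' p t tt0; field; rewrite j0 j'0 tt0.
Qed.

End Modularity.

Theorem theorem1p1 (R : realType) (k : nat) (hk : (2 <= k)%N)
    (g : 'M[int]_2) (hg : \det g = 1) (m n : 'rV[int]_(k - 1))
    (tau : R[i]) (htau : 0 < complex.Im tau)
    (z : 'rV[R[i]]_(k - 1)) (hz : forall j, ~ lattice tau (z 0 j)) :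
  zetahat (mobius g tau) ((automorphy g tau)^-1 *: z)
    = automorphy g tau *: zetahat tau z
  /\ zetahat tau (z + tau *: map_mx intr m + map_mx intr n) = zetahat tau z.
Proof.
(* The group does not act on [e1] and [e2], so both identities are checked on each coefficient,
   which involves a single [z_j]. *)
split; apply: val_inj; rewrite /= /zetahat_poly.
  rewrite scaler_sumr; apply: eq_bigr => j _.
  by rewrite !mxE zetastar_mobius// scalerA mulrCA.
apply: eq_bigr => j _; rewrite !mxE addrAC [tau * _]mulrC.
by rewrite zetastar_periodic.
Qed.
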